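(* Let $s_2 \ge s_1 \ge 2$ be integers, let $s := s_1+s_2$, and let $\mathbb{B}$ be a connected $s_1$ by $s_2$ bipartite graph with covering number $\tau(\mathbb{B}) = s_1$. Then there is $n_0$ such that for every $n \ge n_0$, $$\mathrm{ex}\left(n,(t+1)\mathbb{B}\right) = \binom{n}{2} - \binom{n-s_1(t+1)+1}{2} + \mathrm{ex}\left(n-s_1(t+1)+1,\ \mathbb{B}[s_2+1]\right)$$ holds for all integers $t$ satisfying $$\max\left\{\sqrt{32 s_1 s n},\ \frac{12800 e s^5}{s_1}\left(\frac{\mathrm{ex}(n,\mathbb{B})}{n-1} + 576 e s_1 s^2\right)\right\} \le t \le \frac{n}{1024 e s_1 s^3}.$$
   Context: An $s_1$ by $s_2$ bipartite graph is a graph whose vertex set is partitioned into $W_1,W_2$ with $|W_1|=s_1$, $|W_2|=s_2$ such that every edge joins $W_1$ and $W_2$. The covering number $\tau(F)$ is the minimum size of a set of vertices meeting every edge of $F$. For a graph $F$ and integer $k$, $F[k]$ denotes the family $\{F[S] : S\subseteq V(F),\ |S|=k\}$ of induced subgraphs of $F$ on $k$ vertices. For a family $\mathcal{F}$, $\mathrm{ex}(n,\mathcal{F})$ is the maximum number of edges of an $n$-vertex graph containing no member of $\mathcal{F}$ as a subgraph; $\mathrm{ex}(n,F)=\mathrm{ex}(n,\{F\})$; and $\mathrm{ex}(n,(t+1)F)$ is the maximum number of edges of an $n$-vertex graph not containing $t+1$ pairwise vertex-disjoint copies of $F$. $e$ is Euler's number. *)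

(* Defs.v *)
From mathcomp Require Import all_boot.
From Stdlib Require Import Reals.
Set Implicit Arguments. Unset Strict Implicit. Unset Printing Implicit Defensive.

Definition simple_graph (T : finType) (E : {set {set T}}) : bool :=
  [forall e in E, #|e| == 2].

Definition adj (T : finType) (E : {set {set T}}) : rel T :=
  fun x y => [set x; y] \in E.

Definition connected_graph (T : finType) (E : {set {set T}}) : Prop :=
  forall x y : T, connect (adj E) x y.

Definition bipartite_parts (T : finType) (E : {set {set T}}) (W1 : {set T})
  (s1 s2 : nat) : Prop :=
  [/\ simple_graph E, #|W1| = s1, #|~: W1| = s2 &
      forall e, e \in E -> #|e :&: W1| = 1].

Definition vertex_cover (T : finType) (E : {set {set T}}) (A : {set T}) : bool :=
  [forall e in E, e :&: A != set0].

Definition cover_number (T : finType) (E : {set {set T}}) : nat :=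
  \big[minn/#|T|]_(A : {set T} | vertex_cover E A) #|A|.

Definition embeds_on (T1 T2 : finType) (S : {set T1}) (F : {set {set T1}})
  (G : {set {set T2}}) : bool :=
  [exists f : {ffun T1 -> T2},
     [forall x in S, forall y in S, (f x == f y) ==> (x == y)] &&
     [forall e in F, (e \subset S) ==> ((f @: e) \in G)]].

Definition contains (T1 T2 : finType) (F : {set {set T1}}) (G : {set {set T2}}) : bool :=
  embeds_on setT F G.

(* G contains some member of F[k] = {F[S] : |S| = k} *)
Definition contains_induced_k (T1 T2 : finType) (F : {set {set T1}}) (k : nat)
  (G : {set {set T2}}) : bool :=
  [exists S : {set T1}, (#|S| == k) && embeds_on S F G].

Definition disj_copies (T : finType) (m : nat) (F : {set {set T}})
  : {set {set ('I_m * T)}} :=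
  [set [set (i, x) | x in e] | i : 'I_m in setT, e : {set T} in F].

Definition ex (n : nat) (bad : {set {set 'I_n}} -> bool) : nat :=
  \max_(E : {set {set 'I_n}} | simple_graph E && ~~ bad E) #|E|.
Arguments ex : clear implicits.

(* Main.v *)
(* The lower bound joins m = s1 (t + 1) - 1 full vertices to an extremal
   B[s2 + 1]-free graph: among t + 1 disjoint copies of B one uses at most s1 - 1
   of the full vertices, and the rest of it contains a member of B[s2 + 1].

   For the upper bound, let G have more edges and no t + 1 disjoint copies. If U
   is the union of a maximal packing, few edges avoid U or lie inside U, so about
   s1 t n edges join U to its complement. By iterated pigeonhole such a dense
   pair contains K_{s1,s2} with its small side in U as long as a small multiple
   of t n edges is left. Packing these first at vertices of U whose degree is not
   close to n deletes fewer edges per copy, and would produce t + 1 copies unless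
   nearly (1 - 1/7s1) s1 t vertices have degree close to n.

   Let A consist of m - q such vertices. A piece outside A (a member of
   B[s2 + 1] on vertices seeing most of A, a star, or a copy of B) completes to a
   copy of B by s1 - 1 vertices of A, and any other s1 vertices of A yield one
   more copy; so at most q disjoint pieces exist outside A. Deleting a maximal
   family of pieces leaves a B[s2 + 1]-free part, plus vertices missing a fixed
   proportion of A. These last ones span a B-free graph, whose density is at most
   twice ex(n, B) / n, so the edges they contribute are fewer than the edges to A
   they miss. Hence G has at most the claimed number of edges. *)

Require Import Defs.
From mathcomp Require Import all_boot zify.
From Stdlib Require Import Reals Classical Lra.
Set Implicit Arguments. Unset Strict Implicit. Unset Printing Implicit Defensive.

(** Matches the elements of [S :\: S0] with those of [G :\: f @: S0] by their index in the
    enumerations; [#|S| <= #|G|] leaves enough targets. With [S0] empty this produces an arbitrary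
    injection of [S] into [G]. *)
Lemma inj_extend (T1 T2 : finType) (S0 S : {set T1}) (G : {set T2}) (f : T1 -> T2) :
  {in S0 &, injective f} -> {in S0, forall x, f x \in G} ->
  S0 \subset S -> #|S| <= #|G| ->
  exists g : T1 -> T2, [/\ {in S &, injective g}, {in S, forall x, g x \in G}
                         & {in S0, g =1 f}].
Proof.
move=> finj fG sub leSG.
have cardS0 : #|f @: S0| = #|S0| by rewrite card_in_imset.
have leD : #|S :\: S0| <= #|G :\: f @: S0|.
  have subG : f @: S0 \subset G by apply/subsetP => _ /imsetP[x xS0 ->]; exact: fG.
  by rewrite !cardsD (setIidPr sub) (setIidPr subG) cardS0 leq_sub2r.
case: (posnP #|S|) => [/eqP | S_gt0].
  rewrite cards_eq0 => /eqP S0e; exists f.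
  have S00 : S0 = set0 by apply/eqP; rewrite -subset0 -S0e.
  by split=> // x; rewrite S0e inE.
have [y0 _] : exists y0, y0 \in G by apply/card_gt0P; exact: leq_trans leSG.
pose eS := enum (S :\: S0); pose eG := enum (G :\: f @: S0).
have szS : size eS = #|S :\: S0| by rewrite -cardE.
have szG : size eG = #|G :\: f @: S0| by rewrite -cardE.
pose g x := if x \in S0 then f x else nth y0 eG (index x eS).
have idx x : x \in S -> x \notin S0 -> index x eS < size eG.
  move=> xS xS0; rewrite szG; apply: leq_trans leD; rewrite -szS index_mem.
  by rewrite mem_enum !inE xS0.
have gD x : x \in S -> x \notin S0 -> g x \in G :\: f @: S0.
  move=> xS xS0; rewrite /g (negPf xS0) -mem_enum; apply: mem_nth; exact: idx.
exists g; split=> [x y xS yS | x xS | x xS0]; last by rewrite /g xS0.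
  case: (boolP (x \in S0)) (gD x xS) => xS0; case: (boolP (y \in S0)) (gD y yS) => yS0.
  - by move=> _ _; rewrite /g xS0 yS0; exact: finj.
  - move=> /(_ isT) + _ eqg; rewrite -eqg /g xS0 inE => /andP[/negP[]].
    exact: imset_f.
  - move=> _ /(_ isT) + eqg; rewrite eqg /g yS0 inE => /andP[/negP[]].
    exact: imset_f.
  move=> _ _; rewrite /g (negPf xS0) (negPf yS0) => /eqP.
  rewrite nth_uniq ?idx ?enum_uniq // => /eqP /(congr1 (nth x eS)).
  by rewrite !nth_index // mem_enum !inE ?xS0 ?yS0.
case: (boolP (x \in S0)) => xS0; first by rewrite /g xS0 fG.
by have := gD x xS xS0; rewrite inE => /andP[].
Qed.

Lemma subset_card_eq (T : finType) (X : {set T}) (k : nat) :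
  k <= #|X| -> exists2 Y : {set T}, Y \subset X & #|Y| = k.
Proof.
move=> lek; have : 0 < #|[set Y : {set T} | Y \subset X & #|Y| == k]|.
  by rewrite cards_draws bin_gt0.
by case/card_gt0P=> Y; rewrite inE => /andP[sub /eqP]; exists Y.
Qed.

(** * Degrees, non-degrees and ordered adjacent pairs *)

Section Arcs.
Variables (V : finType) (r : rel V).
Hypothesis rsym : symmetric r.
Implicit Types (x y : V) (X Y Z P Q : {set V}).

(* [codeg] counts x itself, and [arcs] counts ordered pairs, hence every edge
   inside X twice in [arcs X X]. *)
Definition deg (x : V) (Y : {set V}) : nat := \sum_(y in Y) r x y.
Definition codeg (x : V) (Y : {set V}) : nat := \sum_(y in Y) ~~ r x y.
Definition arcs (X Y : {set V}) : nat := \sum_(x in X) deg x Y.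

Lemma deg_card x Y : deg x Y = #|[set y in Y | r x y]|.
Proof.
rewrite -sum1_card /deg big_mkcond [RHS]big_mkcond /=.
by apply: eq_bigr => y _; rewrite !inE; case: (y \in Y); case: (r x y).
Qed.

Lemma deg_codeg x Y : deg x Y + codeg x Y = #|Y|.
Proof.
by rewrite -big_split -sum1_card; apply: eq_bigr => y _ /=; case: (r x y).
Qed.

Lemma deg_le x Y : deg x Y <= #|Y|.
Proof. by rewrite -(deg_codeg x Y) leq_addr. Qed.

Lemma degID x Y Z : deg x Y = deg x (Y :&: Z) + deg x (Y :\: Z).
Proof. exact: big_setID. Qed.

Lemma codegID x Y Z : codeg x Y = codeg x (Y :&: Z) + codeg x (Y :\: Z).
Proof. exact: big_setID. Qed.

Lemma degS x Y Z : Y \subset Z -> deg x Y <= deg x Z.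
Proof. by move=> /setIidPr YZ; rewrite (degID x Z Y) YZ leq_addr. Qed.

Lemma codegS x Y Z : Y \subset Z -> codeg x Y <= codeg x Z.
Proof. by move=> /setIidPr YZ; rewrite (codegID x Z Y) YZ leq_addr. Qed.

Lemma degD x Y Z : deg x Y <= deg x (Y :\: Z) + #|Z|.
Proof.
rewrite (degID x Y Z) addnC leq_add2l; apply: leq_trans (deg_le _ _) _.
by apply: subset_leq_card; apply: subsetIr.
Qed.

Lemma arcsC X Y : arcs X Y = arcs Y X.
Proof.
rewrite /arcs /deg exchange_big /=.
by apply: eq_bigr => y _; apply: eq_bigr => x _; rewrite rsym.
Qed.

Lemma arcsIDl X Y Z : arcs X Y = arcs (X :&: Z) Y + arcs (X :\: Z) Y.
Proof. exact: big_setID. Qed.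

Lemma arcsIDr X Y Z : arcs X Y = arcs X (Y :&: Z) + arcs X (Y :\: Z).
Proof. by rewrite arcsC (arcsIDl _ _ Z) 2!(arcsC X). Qed.

Lemma arcsSl X X' Y : X \subset X' -> arcs X Y <= arcs X' Y.
Proof. by move=> /setIidPr sub; rewrite (arcsIDl X' Y X) sub leq_addr. Qed.

Lemma arcs_le X Y k : {in X, forall x, deg x Y <= k} -> arcs X Y <= #|X| * k.
Proof. by move=> le; rewrite -sum_nat_const; apply: leq_sum. Qed.

Lemma arcs_ge X Y k : {in X, forall x, k <= deg x Y} -> #|X| * k <= arcs X Y.
Proof. by move=> le; rewrite -sum_nat_const; apply: leq_sum. Qed.

Lemma arcs_le_card X Y : arcs X Y <= #|X| * #|Y|.
Proof. by apply: arcs_le => x _; apply: deg_le. Qed.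

Lemma arcs_codeg X Y : arcs X Y + \sum_(x in X) codeg x Y = #|X| * #|Y|.
Proof.
by rewrite -big_split -sum_nat_const; apply: eq_bigr => x _; rewrite /= deg_codeg.
Qed.

Lemma arcs_split X Y : Y \subset X ->
  arcs X X = arcs Y Y + 2 * arcs Y (X :\: Y) + arcs (X :\: Y) (X :\: Y).
Proof.
move=> /setIidPr XY; rewrite (arcsIDl X X Y) XY (arcsIDr Y X Y) XY.
by rewrite (arcsIDr (X :\: Y) X Y) XY (arcsC (X :\: Y) Y); lia.
Qed.

Lemma arcs_delete X Y P Q :
  arcs X Y <= arcs (X :\: P) (Y :\: Q) + \sum_(p in P) deg p Y + \sum_(q in Q) deg q X.
Proof.
rewrite (arcsIDl X Y P) (arcsIDr (X :\: P) Y Q).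
have le1 : arcs (X :&: P) Y <= arcs P Y by apply: arcsSl; apply: subsetIr.
have le2 : arcs (X :\: P) (Y :&: Q) <= arcs Q X.
  rewrite arcsC; apply: leq_trans (arcsSl _ (subsetIr Y Q)) _.
  by rewrite !(arcsC Q); apply: arcsSl; apply: subsetDl.
rewrite /arcs in le1 le2 *; lia.
Qed.

Definition common (P Y : {set V}) : {set V} := [set y in Y | [forall p in P, r p y]].

Lemma commonP P Y y :
  reflect (y \in Y /\ {in P, forall p, r p y}) (y \in common P Y).
Proof.
rewrite inE; apply: (iffP andP) => -[yY].
  by move/forall_inP.
by move=> h; split=> //; apply/forall_inP.
Qed.

Lemma card_common P Y : #|Y| <= #|common P Y| + \sum_(p in P) codeg p Y.
Proof.
have -> : #|common P Y| = \sum_(y in Y) [forall p in P, r p y].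
  rewrite -sum1_card /common big_mkcond [RHS]big_mkcond /=.
  by apply: eq_bigr => y _; rewrite !inE; case: (y \in Y) => //=; case: ifP.
rewrite /codeg exchange_big -big_split -sum1_card; apply: leq_sum => y _ /=.
case: (boolP [forall _ in _, _]) => // /forall_inPn[p pP npy].
by rewrite (bigD1 p) //= npy; lia.
Qed.

(** Union bound: a vertex of [Y] outside [common P Y] is missed by some member of [P], and each
    member misses at most [k]. *)
Lemma card_common_ge P Y k :
  {in P, forall p, codeg p Y <= k} -> #|Y| - #|P| * k <= #|common P Y|.
Proof.
move=> le; have := card_common P Y.
have : \sum_(p in P) codeg p Y <= #|P| * k.
  by rewrite -sum_nat_const; apply: leq_sum.
lia.
Qed.

End Arcs.

(** * Greedy packings *)

Section Packing.
Variables (V : finType) (P : {set V} -> Prop).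

Fixpoint packing (k : nat) (W : {set V}) : Prop :=
  if k is k'.+1 then exists Y, [/\ P Y, Y \subset W & packing k' (W :\: Y)]
  else True.

Lemma packing_sub k (W W' : {set V}) : W \subset W' -> packing k W -> packing k W'.
Proof.
elim: k W W' => //= k IH W W' sub [Y [PY YW pk]].
exists Y; split=> //; first exact: subset_trans sub.
by apply: IH pk; apply: setSD.
Qed.

(** The discarded set [D] may exceed [Y], so a copy known only to lie inside [D] can be removed
    together with all of [D]. *)
Lemma packingS k (Y D W : {set V}) :
  P Y -> Y \subset D -> D \subset W -> packing k (W :\: D) -> packing k.+1 W.
Proof.
move=> PY YD DW pk; exists Y; split=> //; first exact: subset_trans DW.
by apply: packing_sub pk; apply: setDS.
Qed.

(** Greedy removal either reaches [k.+1] disjoint sets or stops with at most [k] of them. The union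
    is padded to at least [k] elements because its deletion must later leave at most [N]
    vertices. *)
Lemma maximal_packing s k (W : {set V}) :
  (forall Y : {set V}, P Y -> 0 < #|Y| <= s) -> s * k <= #|W| -> 0 < s ->
  packing k.+1 W \/
  exists Y : {set V}, [/\ Y \subset W, k <= #|Y|, #|Y| <= s * k
              & forall Z : {set V}, Z \subset W :\: Y -> ~ P Z].
Proof.
move=> Ps + s_gt0; elim: k W => [|k IH] W leW.
  case: (classic (exists Y, P Y /\ Y \subset W)) => [[Y [PY YW]]|no].
    by left; exists Y.
  right; exists set0; rewrite sub0set cards0; split=> // Z.
  by rewrite setD0 => ZW PZ; apply: no; exists Z.
case: (classic (exists Y, P Y /\ Y \subset W)) => [[Y [PY YW]]|no]; last first.
  (* [W] contains no set satisfying [P], so any subset of [W] will do; [k.+1] elements meet the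
     lower bound on the size. *)
  have [|Y YW cY] := @subset_card_eq _ W k.+1.
    by apply: leq_trans leW; rewrite leq_pmull.
  right; exists Y; split=> //; rewrite ?cY ?leq_pmull // => Z ZW PZ.
  by apply: no; exists Z; split=> //; apply: subset_trans ZW (subsetDl _ _).
have /andP[Y0 Ys] := Ps _ PY.
have cWY : #|W :\: Y| + #|Y| = #|W| by rewrite -(cardsID Y W) (setIidPr YW) addnC.
have [|pk|[Y' [Y'W lek ges noP]]] := IH (W :\: Y); first by lia.
  by left; exists Y.
right; exists (Y :|: Y').
have dis : [disjoint Y & Y'].
  by rewrite disjoint_sym; apply: disjointWl Y'W _; rewrite -setI_eq0 setIDAC setDIl setDv setI0.
move: (dis); rewrite -leq_card_setU => /eqP cU; rewrite cU; split; try lia.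
  by rewrite subUset YW (subset_trans Y'W) // subsetDl.
by move=> Z; rewrite -setDDl; apply: noP.
Qed.

End Packing.

(** * Assembling disjoint copies from vertices of nearly full degree *)

Section Copies.
Variables (T V : finType) (b : rel T) (W1 : {set T}) (r : rel V).
Hypothesis bip : forall x y, b x y -> (x \in W1) != (y \in W1).
Hypothesis rsym : symmetric r.
Implicit Types (A H P Q W X Y Z : {set V}) (f : T -> V).

Definition copy f : Prop := injective f /\ forall x y, b x y -> r (f x) (f y).

Definition hosts Y : Prop := exists2 f, copy f & f @: setT = Y.

Lemma card_copy f : copy f -> #|f @: setT| = #|T|.
Proof. by case=> finj _; rewrite card_imset // cardsT. Qed.

Lemma copy_bip P Q : 0 < #|W1| ->
  #|P| = #|W1| -> #|Q| = #|~: W1| -> [disjoint P & Q] ->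
  {in P & Q, forall p q, r p q} ->
  exists2 f, copy f & f @: setT \subset P :|: Q.
Proof.
move=> W1_gt0 cP cQ dis full.
have /card_gt0P[p0 _] : 0 < #|P| by rewrite cP.
have noT (S : {set T}) (G : {set V}) : #|S| <= #|G| ->
    exists g : T -> V, {in S &, injective g} /\ {in S, forall x, g x \in G}.
  move=> le; have [||||g [ginj gG _]] := @inj_extend _ _ set0 S G (fun=> p0) => //.
  - by move=> x; rewrite inE.
  - by move=> x; rewrite inE.
  - by rewrite sub0set.
  by exists g.
have [|g1 [inj1 g1P]] := noT W1 P; first by rewrite cP.
have [|g2 [inj2 g2Q]] := noT (~: W1) Q; first by rewrite cQ.
have g2Q' x : x \notin W1 -> g2 x \in Q by move=> xW; apply: g2Q; rewrite inE.
pose f x := if x \in W1 then g1 x else g2 x.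
have PQ p q : p \in P -> q \in Q -> p <> q.
  by move=> pP qQ pq; move/pred0P: dis => /(_ p) /=; rewrite pP pq qQ.
exists f; last first.
  apply/subsetP => _ /imsetP[x _ ->]; rewrite inE /f.
  by case: ifPn => xW; rewrite ?g1P ?g2Q' ?orbT.
split=> [x y|x y]; rewrite /f.
  case: ifPn => xW; case: ifPn => yW eqf.
  - exact: inj1.
  - by case: (PQ _ _ (g1P x xW) (g2Q' y yW)).
  - by case: (PQ _ _ (g1P y yW) (g2Q' x xW)).
  by apply: inj2; rewrite ?inE.
move/bip; case: ifPn => xW; case: ifPn => yW //= _; first by rewrite full ?g1P ?g2Q'.
by rewrite rsym full ?g1P ?g2Q'.
Qed.

Hypothesis W1_gt0 : 0 < #|W1|.
Variables (A H : {set V}) (d M : nat).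
Hypothesis Adeg : {in A, forall v, codeg r v setT <= d}.
Let s1 := #|W1|.
Let s2 := #|~: W1|.

Lemma cardT_W1 : #|T| = s1 + s2.
Proof. by rewrite /s1 /s2 cardsC. Qed.

Lemma card_setD_ge X Y : #|X| - #|Y| <= #|X :\: Y|.
Proof. by rewrite cardsD leq_sub2l // subset_leq_card // subsetIr. Qed.

Lemma card_common_A P Y : P \subset A -> #|Y| - #|P| * d <= #|common r P Y|.
Proof.
move=> PA; apply: card_common_ge => p pP; apply: leq_trans (Adeg (subsetP PA _ pP)).
by apply: codegS.
Qed.

(** Each copy takes [s1] vertices of the reserve [A'] and [s2] of their common neighbours outside
    [A]. At most [M] vertices are ever used, so the first hypothesis keeps enough common neighbours
    available to the end. *)
Lemma packing_full k W A' :
  s1 * d + M + #|A| + s2 <= #|V| ->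
  A' \subset A :&: W -> s1 * k <= #|A'| -> #|~: W| + #|T| * k <= M ->
  packing hosts k W.
Proof.
move=> big; elim: k W A' => // k IH W A'; rewrite subsetI => /andP[A'A A'W] leA leM.
have [|P PA cP] := @subset_card_eq _ A' s1; first by apply: leq_trans leA; rewrite mulnS leq_addr.
have PA0 := subset_trans PA A'A.
have cW : #|W :\: A| + #|~: W| + #|A| >= #|V|.
  move: (card_setD_ge W A) (cardsC W); clear; lia.
have [|Q QC cQ] := @subset_card_eq _ (common r P (W :\: A)) s2.
  by move: (card_common_A (W :\: A) PA0); rewrite cP; move: cW big (leq_trans (leq_addr _ _) leM); clear; lia.
have QW q : q \in Q -> [/\ q \notin A, q \in W & {in P, forall p, r p q}].
  by move/(subsetP QC)/commonP=> [+ full]; rewrite inE => /andP[-> ->].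
have dis : [disjoint P & Q].
  rewrite disjoint_sym disjoint_subset; apply/subsetP=> q /QW[qA _ _].
  by rewrite inE; apply: contra qA; apply: (subsetP PA0).
have [f fc fPQ] := copy_bip W1_gt0 cP cQ dis (fun p q pP qQ => let: And3 _ _ h := QW q qQ in h p pP).
have QsW : Q \subset W by apply/subsetP => q /QW[].
have PsW : P \subset W by apply: subset_trans A'W.
apply: (packingS (Y := f @: setT) _ fPQ); first by exists f.
  by rewrite subUset PsW.
apply: (IH _ (A' :\: P)).
- rewrite subsetI (subset_trans (subsetDl _ _) A'A) /=.
  apply/subsetP => x; rewrite !inE => /andP[/negPf-> xA']; rewrite (subsetP A'W) // andbT /=.
  by apply/negP => /QW[]; rewrite (subsetP A'A).
- by move: leA; rewrite mulnS; move: cP (card_setD_ge A' P); clear; lia.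
have : #|~: (W :\: (P :|: Q))| <= #|~: W| + #|P :|: Q|.
  by rewrite setCD; apply: leq_card_setU.
move: (leq_card_setU P Q).1 leM; rewrite cP cQ -/s2 cardT_W1 mulnS; clear; lia.
Qed.

(** A vertex of [H] replaces one vertex of [A] in its copy, so each of the first [h] copies costs
    only [s1.-1] vertices of the reserve. The other side is chosen outside both [A] and [H], which
    leaves the remaining members of [H] untouched. *)
Lemma packing_star thr h k W A' H' :
  s1 * d + M + #|A| + s2 <= #|V| -> s1 * d + M + #|H| + s2 <= thr ->
  {in H, forall x, thr <= deg r x (~: A)} -> [disjoint A & H] ->
  H' \subset H :&: W -> #|H'| = h ->
  A' \subset A :&: W -> s1 * k + s1.-1 * h <= #|A'| ->
  #|~: W| + #|T| * (h + k) <= M ->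
  packing hosts (h + k) W.
Proof.
move=> big bigH Hdeg AH; elim: h W A' H' => [|h IH] W A' H'.
  by rewrite muln0 addn0 add0n => _ _; apply: packing_full.
rewrite !subsetI => /andP[H'H H'W] cH /andP[A'A A'W] leA leM.
have /card_gt0P[x xH'] : 0 < #|H'| by rewrite cH.
have xH := subsetP H'H x xH'.
have xA : x \notin A by move/pred0P: AH => /(_ x) /=; rewrite xH andbT => ->.
have [|P PA cP] := @subset_card_eq _ A' s1.-1; first by apply: leq_trans leA; rewrite mulnS; apply: leq_trans (leq_addl _ _); apply: leq_addr.
have PA0 := subset_trans PA A'A.
pose N := [set y in ~: A | r x y].
have cN : thr <= #|N| by rewrite -deg_card; apply: Hdeg.
have cNW : #|N| <= #|(N :&: W) :\: H| + #|~: W| + #|H|.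
  have := card_setD_ge (N :&: W) H.
  have : #|N :\: W| <= #|~: W| by rewrite setDE subset_leq_card // subsetIr.
  move: (cardsID W N); clear; lia.
have [|Q QC cQ] := @subset_card_eq _ (common r P ((N :&: W) :\: H)) s2.
  have := card_common_A ((N :&: W) :\: H) PA0; rewrite cP.
  have : s1.-1 * d <= s1 * d by rewrite leq_mul2r leq_pred orbT.
  move: big bigH cN cNW (leq_trans (leq_addr _ _) leM); clear; lia.
have QW q : q \in Q -> [/\ q \notin A, q \notin H, q \in W, r x q & {in P, forall p, r p q}].
  by move/(subsetP QC)/commonP=> [+ full]; rewrite !inE => /and3P[-> /andP[-> ->] ->].
pose P' := x |: P.
have P'A q : q \in P' -> q \in A \/ q = x.
  by rewrite !inE => /orP[/eqP|/(subsetP PA0)]; [right|left].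
have dis : [disjoint P' & Q].
  rewrite disjoint_sym disjoint_subset; apply/subsetP=> q /QW[qA qH _ _ _].
  by rewrite inE; apply/negP => /P'A[qA'|qx]; [rewrite qA' in qA | rewrite qx xH in qH].
have cP' : #|P'| = #|W1|.
  have xP : x \notin P by apply: contra xA; apply: (subsetP PA0).
  by rewrite cardsU1 xP cP add1n prednK.
have full : {in P' & Q, forall p q, r p q}.
  by move=> p q pP /QW[_ _ _ rx rP]; move: pP; rewrite !inE => /orP[/eqP->|/rP].
have [f fc fPQ] := copy_bip W1_gt0 cP' cQ dis full.
have QsW : Q \subset W by apply/subsetP => q /QW[].
have PsW : P' \subset W.
  by rewrite subUset sub1set (subsetP H'W) // (subset_trans PA).
apply: (packingS (Y := f @: setT) _ fPQ); first by exists f.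
  by rewrite subUset PsW.
apply: (IH _ (A' :\: P) (H' :\ x)).
- rewrite subsetI (subset_trans (subsetDl _ _) H'H) /=.
  apply/subsetP => y; rewrite !inE => /andP[/negPf-> yH']; rewrite (subsetP H'W) // andbT /=.
  have yH := subsetP H'H y yH'; apply/negP => /orP[/(subsetP PA0) yA|/QW[_]].
    by move/pred0P: AH => /(_ y) /=; rewrite yH yA.
  by rewrite yH.
- by move: (cardsD1 x H'); rewrite xH' cH; clear; lia.
- rewrite subsetI (subset_trans (subsetDl _ _) A'A) /=.
  apply/subsetP => y; rewrite !inE => /andP[/negPf-> yA']; rewrite (subsetP A'W) // andbT orbF.
  have yA := subsetP A'A y yA'; apply/negP => /orP[/eqP yx|/QW[]]; first by rewrite -yx yA in xA.
  by rewrite yA.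
- by move: leA (card_setD_ge A' P); rewrite mulnS cP; clear; lia.
have : #|~: (W :\: (P' :|: Q))| <= #|~: W| + #|P' :|: Q|.
  by rewrite setCD; apply: leq_card_setU.
move: (leq_card_setU P' Q).1 leM; rewrite cP' cQ -/s1 -/s2 cardT_W1 addSn mulnS; clear; lia.
Qed.

(* A unit Y outside A completes to a copy of the pattern at the cost of
   |W1| - 1 vertices of A, whichever q (|W1| - 1) vertices of A are already spent. *)
Definition unit_at q Y : Prop :=
  0 < #|Y| <= #|T| /\
  forall A', A' \subset A -> #|A :\: A'| <= s1.-1 * q ->
  exists f, [/\ copy f, f @: setT \subset Y :|: A' & #|f @: setT :&: A| <= s1.-1].

(** Units are completed first, then the vertices of [H], then copies with a whole side in [A]. A
    completed unit meets only itself and [A], so the other units and [H] survive. The bound on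
    [A :\: A'] keeps the spent part of [A] within what [unit_at] tolerates at each of the [u]
    steps. *)
Lemma packing_units thr q u h k W A' X H' :
  s1 * d + M + #|A| + s2 <= #|V| -> s1 * d + M + #|H| + s2 <= thr ->
  {in H, forall x, thr <= deg r x (~: A)} -> [disjoint A & H] ->
  packing (unit_at q) u X -> X \subset W -> [disjoint X & A :|: H] ->
  H' \subset H :&: W -> #|H'| = h ->
  A' \subset A :&: W -> s1 * k + s1.-1 * (u + h) <= #|A'| ->
  #|A :\: A'| + s1.-1 * u <= s1.-1 * q.+1 ->
  #|~: W| + #|T| * (u + h + k) <= M ->
  packing hosts (u + h + k) W.
Proof.
move=> big bigH Hdeg AH; elim: u W A' X => [|u IH] W A' X.
  by rewrite add0n => _ _ _ H'H cH A'A leA _; apply: (packing_star big bigH Hdeg AH H'H cH A'A).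
case=> Y [[/andP[Y0 Ys] Yunit] YX pk] XW dXAH H'HW cH; rewrite subsetI => /andP[A'A A'W] leA leq1 leM.
have [||f [fc fY fA]] := Yunit A' => //; first by move: leq1; rewrite !mulnS; move: (_ * u) => z; clear; lia.
set D := f @: setT in fY fA.
have cD : #|D| = #|T| by apply: card_copy.
have notX y : y \in X -> (y \notin A) /\ (y \notin H).
  by move=> yX; move/pred0P: dXAH => /(_ y) /=; rewrite yX inE => /negbT; rewrite negb_or => /andP[].
pose D' := D :|: Y.
have YW := subset_trans YX XW.
have DA : D' :&: A = D :&: A.
  apply/setP => y; rewrite !inE; case: (boolP (y \in Y)) => yY; last by rewrite orbF.
  by have [/negPf-> _] := notX y (subsetP YX _ yY); rewrite !andbF.
apply: (packing_sub (W := W)) => //.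
apply: (packingS (Y := D) (D := D)); first by exists f.
- by [].
- by apply: subset_trans fY _; rewrite subUset YW.
rewrite -/(_ + _).
have DX y : y \in D -> y \in Y \/ y \in A by move/(subsetP fY); rewrite inE => /orP[|/(subsetP A'A)]; [left|right].
apply: (IH _ (A' :\: D) (X :\: Y)) => //.
- apply/subsetP => y; rewrite !inE => /andP[yY yX]; rewrite (subsetP XW) // andbT.
  apply/negP => /DX[|yA]; first by apply/negP.
  by have [] := notX y yX; rewrite yA.
- by apply: disjointWl dXAH; apply: subsetDl.
- move: H'HW; rewrite !subsetI => /andP[H'H H'W]; rewrite H'H /=.
  apply/subsetP => y yH'; rewrite inE (subsetP H'W) // andbT.
  have yH := subsetP H'H y yH'; apply/negP => /DX[/(subsetP YX)/notX[_]|yA]; first by rewrite yH.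
  by move/pred0P: AH => /(_ y) /=; rewrite yH yA.
- rewrite subsetI (subset_trans (subsetDl _ _) A'A) /=.
  by apply: setSD.
- have : #|A'| <= #|A' :\: D| + #|D :&: A|.
    rewrite -(cardsID D A') addnC leq_add2l; apply: subset_leq_card.
    by rewrite setIC; apply: setIS.
  by move: leA fA; rewrite !addSn mulnS; clear; lia.
- have : #|A :\: (A' :\: D)| <= #|A :\: A'| + #|D :&: A|.
    apply: leq_trans (leq_card_setU _ _); apply: subset_leq_card.
    by apply/subsetP => y; rewrite !inE; case: (y \in A); case: (y \in A'); case: (y \in D).
  by move: leq1 fA; rewrite !mulnS; clear; lia.
have : #|~: (W :\: D)| <= #|~: W| + #|D|.
  by rewrite setCD; apply: leq_card_setU.
by move: leM; rewrite cD !addSn mulnS; clear; lia.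
Qed.

End Copies.

(** * Stability: packing in a dense pair *)

Section KST.
Variables (V : finType) (r : rel V).
Hypothesis rsym : symmetric r.
Implicit Types (P Q R X : {set V}).

(** Double counting: [R] sends at least [#|R| * e] arcs to fewer than [M * e] vertices, so some
    vertex of [X] receives at least a 1/[M] share of [R]. *)
Lemma popular_vertex X R e M :
  {in R, forall v, e <= deg r v X} -> #|X| < M * e -> 0 < #|R| ->
  exists2 x, x \in X & #|R| <= M * deg r x R.
Proof.
move=> Rdeg ltX R_gt0; apply: NNPP => no.
have le x : x \in X -> M * deg r x R <= #|R|.
  by move=> xX; rewrite leqNgt; apply/negP => /ltnW lt; apply: no; exists x.
have := arcs_ge Rdeg; rewrite (arcsC rsym) => geR.
have : M * arcs r X R <= #|X| * #|R|.
  by rewrite /arcs big_distrr -sum_nat_const /=; apply: leq_sum.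
have : #|X| * #|R| < M * e * #|R| by rewrite ltn_pmul2r.
have : M * (#|R| * e) <= M * arcs r X R by rewrite leq_mul2l geR orbT.
rewrite -mulnA [e * _]mulnC; lia.
Qed.

(** Popular vertices are picked one at a time, each shrinking [R] by a factor of at most [M]. The
    surplus [i] in the degree condition pays for the vertices already picked, which must be
    avoided. *)
Lemma complete_pair_step X R e M i :
  {in R, forall v, e + i <= deg r v X} -> #|X| < M * e -> 0 < #|R| ->
  exists P R', [/\ P \subset X, #|P| = i, R' \subset R, #|R| <= expn M i * #|R'|
                 & {in P & R', forall p q, r p q}].
Proof.
elim: i e => [|i IH] e Rdeg ltX R_gt0.
  exists set0, R; rewrite sub0set cards0 expn0 mul1n; split=> // p q.
  by rewrite inE.
have [|||P [R' [PX cP R'R leR full]]] := IH e.+1 => //.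
- by move=> v /Rdeg; rewrite addnS.
- by apply: leq_trans ltX _; rewrite leq_mul2l leqnSn orbT.
have R'_gt0 : 0 < #|R'| by case: #|R'| leR => //; rewrite muln0; lia.
have [||//|x] := @popular_vertex (X :\: P) R' e M.
- move=> v vR'; have := Rdeg v (subsetP R'R v vR'); have := degD r v X P; lia.
- by apply: leq_ltn_trans ltX; apply: subset_leq_card; apply: subsetDl.
rewrite inE => /andP[xP xX] lex.
exists (x |: P), [set y in R' | r x y]; split.
- by rewrite subUset sub1set xX.
- by rewrite cardsU1 xP cP.
- by apply: subset_trans R'R; apply/subsetP => y; rewrite inE => /andP[].
- rewrite -deg_card expnSr -mulnA; apply: leq_trans leR _.
  by rewrite leq_mul2l lex orbT.
by move=> p q; rewrite !inE => /orP[/eqP->|pP] /andP[qR' rxq] //; apply: full.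
Qed.

(** Vertices of [R] with degree below [e + i] account for the first summand of the arc bound. The
    second would cover all the others if there were at most [expn M i * j] of them, so more than
    that many remain for the iterated choice. *)
Lemma complete_pair X R e M i j :
  #|X| < M * e -> #|R| * (e + i) + #|X| * (expn M i * j) < arcs r X R ->
  exists P Q, [/\ P \subset X, Q \subset R, #|P| = i, #|Q| = j
                & {in P & Q, forall p q, r p q}].
Proof.
move=> ltX big; pose R0 := [set v in R | e + i <= deg r v X].
have cR0 : expn M i * j < #|R0|.
  rewrite ltnNge; apply/negP => le; move: big; apply/negP; rewrite -leqNgt.
  rewrite (arcsC rsym) (arcsIDl r R X R0).
  have R0R : R0 \subset R by apply/subsetP => y; rewrite inE => /andP[].
  rewrite (setIidPr R0R) addnC; apply: leq_add.
    apply: leq_trans (_ : #|R :\: R0| * (e + i) <= _).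
      apply: arcs_le => v; rewrite !inE => /andP[+ vR]; rewrite vR -ltnNge; exact: ltnW.
    by rewrite leq_mul2r subset_leq_card ?subsetDl ?orbT.
  apply: leq_trans (arcs_le_card _ _ _) _; rewrite mulnC leq_mul2l le orbT //.
have [|||P [R' [PX cP R'R leR full]]] := @complete_pair_step X R0 e M i => //.
- by move=> v; rewrite inE => /andP[].
- by apply: leq_ltn_trans cR0.
have [|Q QR' cQ] := @subset_card_eq _ R' j.
  have := leq_trans cR0 leR; rewrite ltn_mul2l => /andP[_ /ltnW] //.
exists P, Q; split=> //.
  apply: subset_trans QR' (subset_trans R'R _).
  by apply/subsetP => y; rewrite inE => /andP[].
by move=> p q pP /(subsetP QR'); apply: full.
Qed.

End KST.

Section Phases.
Variables (T V : finType) (b : rel T) (W1 : {set T}) (r : rel V).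
Hypothesis bip : forall x y, b x y -> (x \in W1) != (y \in W1).
Hypothesis rsym : symmetric r.
Hypothesis W1_gt0 : 0 < #|W1|.
Variables (U : {set V}) (tau : nat).
Hypothesis dense : forall X R : {set V}, X \subset U -> R \subset ~: U ->
  tau <= arcs r X R ->
  exists P Q : {set V}, [/\ P \subset X, Q \subset R, #|P| = #|W1|, #|Q| = #|~: W1|
                & {in P & Q, forall p q, r p q}].
Local Notation hosts := (hosts b r).
Let s1 := #|W1|.
Let s2 := #|~: W1|.

(** A copy with its [s1] side in [X] and its [s2] side outside [U] destroys at most [dX] arcs per
    vertex of the first side and [#|U|] per vertex of the second. The loss is stated for every [Z]
    inside [U], so that one deletion can be charged both to [L] and to [U]. *)
Lemma phase_step (X W : {set V}) dX : X \subset U ->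
  {in X, forall x, deg r x (~: U) <= dX} -> tau <= arcs r (X :&: W) (~: U :&: W) ->
  exists Y D : {set V}, [/\ hosts Y, Y \subset D, D \subset W &
    forall Z : {set V}, Z \subset U ->
      arcs r (Z :&: W) (~: U :&: W) <=
      arcs r (Z :&: (W :\: D)) (~: U :&: (W :\: D)) + (s1 * dX + s2 * #|U|)].
Proof.
move=> XU Xdeg big.
have [||P [Q [PX QR cP cQ full]]] := dense _ _ big.
- by apply: subset_trans XU; apply: subsetIl.
- exact: subsetIl.
have PU : P \subset U by apply: subset_trans PX (subset_trans (subsetIl _ _) XU).
have QU : Q \subset ~: U by apply: subset_trans QR (subsetIl _ _).
have dis : [disjoint P & Q].
  by apply: disjointWl PU _; rewrite disjoint_sym disjoints_subset.
have [f fc fPQ] := copy_bip bip rsym W1_gt0 cP cQ dis full.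
exists (f @: setT), (P :|: Q); split=> //; first by exists f.
  rewrite subUset (subset_trans PX) ?subsetIr //.
  by rewrite (subset_trans QR) ?subsetIr.
move=> Z ZU.
have -> : Z :&: (W :\: (P :|: Q)) = (Z :&: W) :\: P.
  apply/setP => x; rewrite !inE; case: (boolP (x \in Q)) => xQ; last by case: (x \in P); case: (x \in Z); case: (x \in W).
  have := subsetP QU x xQ; rewrite inE => xU.
  by rewrite (negPf (contra (subsetP ZU x) xU)) !andbF.
have -> : ~: U :&: (W :\: (P :|: Q)) = (~: U :&: W) :\: Q.
  apply/setP => x; rewrite !inE; case: (boolP (x \in P)) => xP; last by case: (x \in Q); case: (x \in U); case: (x \in W).
  by rewrite (subsetP PU x xP) /= andbF.
apply: leq_trans (arcs_delete rsym _ _ P Q) _; rewrite -addnA leq_add2l.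
apply: leq_add.
  rewrite /s1 -cP -sum_nat_const; apply: leq_sum => p /(subsetP PX); rewrite inE => /andP[pX _].
  by apply: leq_trans (Xdeg p pX); apply: degS; apply: subsetIl.
rewrite /s2 -cQ -sum_nat_const; apply: leq_sum => q _; apply: leq_trans (deg_le _ _ _) _.
by apply: subset_leq_card; apply: subset_trans (subsetIl _ _) ZU.
Qed.

Lemma packing_dense k (W : {set V}) :
  k * (s1 * #|V| + s2 * #|U|) + tau <= arcs r (U :&: W) (~: U :&: W) ->
  packing hosts k W.
Proof.
elim: k W => // k IH W; rewrite mulSn => big.
have [||Y [D [hY YD DW del]]] := @phase_step U W #|V| (subxx _).
- by move=> x _; apply: leq_trans (deg_le _ _ _) (max_card _).
- lia.
by apply: (packingS hY YD DW); apply: IH; have := del U (subxx _); lia.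
Qed.

(** The first [k1] copies are rooted in [L], whose smaller degrees make them cheaper; the arcs saved
    allow more copies in total than [packing_dense] alone would give. *)
Lemma packing_two_phases k1 k dL (L W : {set V}) :
  L \subset U -> {in L, forall x, deg r x (~: U) <= dL} ->
  k1 * (s1 * dL + s2 * #|U|) + tau <= arcs r (L :&: W) (~: U :&: W) ->
  k1 * (s1 * dL + s2 * #|U|) + k * (s1 * #|V| + s2 * #|U|) + tau
    <= arcs r (U :&: W) (~: U :&: W) ->
  packing hosts (k1 + k) W.
Proof.
move=> LU Ldeg; elim: k1 W => [|k1 IH] W.
  by rewrite mul0n !add0n => _; apply: packing_dense.
rewrite mulSn => bigL bigU.
have [|Y [D [hY YD DW del]]] := phase_step LU Ldeg (W := W); first by lia.
rewrite addSn; apply: (packingS hY YD DW); apply: IH.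
  by have := del L LU; lia.
by have := del U (subxx _); lia.
Qed.

End Phases.

(** * Units outside the set of nearly full vertices *)

Section Units.
Variables (T V : finType) (b : rel T) (W1 : {set T}) (r : rel V).
Hypothesis bip : forall x y, b x y -> (x \in W1) != (y \in W1).
Hypothesis rsym : symmetric r.
Hypothesis rirr : irreflexive r.
Hypothesis W1_gt0 : 0 < #|W1|.
Variables (A : {set V}) (q : nat).
Let s1 := #|W1|.
Let s2 := #|~: W1|.
Let s := #|T|.
Let a := #|A|.
Hypothesis qA : 4 * (s1.-1 * q + s1) <= a.
Local Notation hosts := (hosts b r).
Local Notation copy := (copy b r).
Implicit Types (P Q R X Y Z : {set V}) (f : T -> V).

(* [good]: vertices outside A that see almost all of A; [core]: vertices of A
   adjacent to almost all of A, from which cliques of size s1 - 1 are extracted.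
   If [core] is small, the pairs missing inside A already outweigh s2 n edges. *)
Definition good : {set V} := [set v in ~: A | 4 * s * codeg r v A <= a].
Definition core : {set V} := [set v in A | 4 * s1 * codeg r v A <= a].

Definition embeds_in (S : {set T}) X : Prop :=
  exists f, [/\ {in S &, injective f}, {in S, forall x, f x \in X}
              & {in S &, forall x y, b x y -> r (f x) (f y)}].

Lemma s_gt0 : 0 < s.
Proof. by rewrite /s (cardT_W1 W1) addn_gt0 W1_gt0. Qed.

(** At most [s] good vertices, each missing at most a/(4s) of [A], together miss at most a quarter
    of [A]. *)
Lemma card_common_good Q (A' : {set V}) : Q \subset good -> #|Q| <= s -> A' \subset A ->
  4 * #|A'| <= 4 * #|common r Q A'| + a.
Proof.
move=> Qg leQ A'A; have := card_common r Q A'.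
set S := \sum_(_ in _) _ => le; suff: 4 * S <= a by move: le; clear; lia.
rewrite -(leq_pmul2l s_gt0) mulnA (mulnC s) big_distrr /=.
apply: leq_trans (_ : #|Q| * a <= _); last by rewrite leq_mul2r leQ orbT.
rewrite -sum_nat_const; apply: leq_sum => v /(subsetP Qg); rewrite inE => /andP[_].
by apply: leq_trans; rewrite leq_mul2l codegS ?orbT.
Qed.

Lemma pool_size (A' : {set V}) : A' \subset A -> #|A :\: A'| <= s1.-1 * q -> a <= #|A'| + s1.-1 * q.
Proof.
move=> A'A; have := cardsID A' A; rewrite (setIidPr A'A) -/a.
by move: (#|A :\: A'|) => z; clear; lia.
Qed.

(** The leaves become the [s2] side; the centre and [s1.-1] common neighbours of the leaves in [A']
    become the [s1] side. *)
Lemma unit_star x Q : x \notin A -> Q \subset good -> #|Q| = s2 ->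
  {in Q, forall y, r x y} -> unit_at b W1 r A q (x |: Q).
Proof.
move=> xA Qg cQ xQ.
have xNQ : x \notin Q by apply/negP => /xQ; rewrite rirr.
split=> [|A' A'A leA'].
  rewrite cardsU1 xNQ cQ add1n /= (cardT_W1 W1) -add1n leq_add2r; exact: W1_gt0.
have leQ : #|Q| <= s by rewrite cQ /s (cardT_W1 W1) leq_addl.
have [|P PC cP] := @subset_card_eq _ (common r Q A') s1.-1.
  move: (card_common_good Qg leQ A'A) (pool_size A'A leA') qA (leq_pred s1).
  by clear; lia.
have PA' : P \subset A' by apply: subset_trans PC _; apply/subsetP => y /commonP[].
have PA := subset_trans PA' A'A.
have QA y : y \in Q -> y \notin A by move/(subsetP Qg); rewrite !inE => /andP[].
have xP : x \notin P by apply: contra xA; apply: (subsetP PA).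
have cP' : #|x |: P| = #|W1| by rewrite cardsU1 xP cP add1n prednK.
have dis : [disjoint x |: P & Q].
  rewrite disjoint_subset; apply/subsetP => y; rewrite !inE => /orP[/eqP->|/(subsetP PA) yA].
    exact: xNQ.
  by apply: contraL yA; apply: QA.
have [|f fc fPQ] := copy_bip bip rsym W1_gt0 cP' cQ dis.
  move=> p y; rewrite !inE => /orP[/eqP->|/(subsetP PC)/commonP[_ h]] yQ; first exact: xQ.
  by rewrite rsym h.
exists f; split=> //.
  apply: subset_trans fPQ _; rewrite -setUA (setUC P) setUA; exact: setUS.
rewrite -cP; apply: subset_leq_card; apply/subsetP => y; rewrite inE => /andP[/(subsetP fPQ)].
rewrite !inE -orbA => /or3P[/eqP->|//|/QA/negPf->//]; by rewrite (negPf xA).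
Qed.

Lemma unit_copy f : copy f -> f @: setT \subset ~: A -> unit_at b W1 r A q (f @: setT).
Proof.
move=> fc fA; split; first by rewrite (card_copy fc) leqnn andbT s_gt0.
move=> A' _ _; exists f; split=> //; first exact: subsetUl.
suff -> : f @: setT :&: A = set0 by rewrite cards0.
by apply/eqP; rewrite setI_eq0 disjoints_subset.
Qed.

(** Greedy choice: passing to the neighbours of a core vertex [p] loses at most a/(4 s1) vertices.
    As [codeg] counts [p] itself, the loss includes [p]. *)
Lemma clique_in k X : X \subset core -> 0 < a -> k * a <= 4 * s1 * #|X| ->
  exists P, [/\ P \subset X, #|P| = k & {in P &, forall x y, x != y -> r x y}].
Proof.
move=> + a_gt0; elim: k X => [|k IH] X XC leX.
  by exists set0; rewrite sub0set cards0; split=> // x y; rewrite inE.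
have /card_gt0P[p pX] : 0 < #|X|.
  by case: #|X| leX => //; rewrite muln0 leqn0 muln_eq0 /= -leqn0 leqNgt a_gt0.
have := subsetP XC p pX; rewrite inE => /andP[pA codp].
have XA : X \subset A by apply/subsetP => y /(subsetP XC); rewrite inE => /andP[].
have NX : [set y in X | r p y] \subset X by apply/subsetP => y; rewrite inE => /andP[].
have [||P [PX cP Pc]] := IH [set y in X | r p y].
- exact: subset_trans XC.
- have : #|X| = #|[set y in X | r p y]| + codeg r p X by rewrite -deg_card deg_codeg.
  have : 4 * s1 * codeg r p X <= a.
    by apply: leq_trans codp; rewrite leq_mul2l codegS ?orbT.
  by move=> + cX; move: leX; rewrite cX mulSn mulnDr; clear; lia.
exists (p |: P); split.
- by rewrite subUset sub1set pX (subset_trans PX).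
- rewrite cardsU1 cP (_ : p \notin P) //.
  by apply/negP => /(subsetP PX); rewrite inE rirr andbF.
have Pp y : y \in P -> r p y by move/(subsetP PX); rewrite inE => /andP[].
move=> x y; rewrite !inE => /orP[/eqP->|xP] /orP[/eqP->|yP]; rewrite ?eqxx //.
- by move=> _; apply: Pp.
- by move=> _; rewrite rsym Pp.
exact: Pc.
Qed.

(** The [s1.-1] pattern vertices outside [S] may be adjacent to one another as well as to [S]. They
    are therefore sent to a clique of core vertices, all adjacent to the image of [S]. *)
Lemma unit_embedding (S : {set T}) f :
  #|S| = s2.+1 -> 4 * #|A :\: core| <= a ->
  {in S &, injective f} -> {in S, forall x, f x \in good} ->
  {in S &, forall x y, b x y -> r (f x) (f y)} ->
  unit_at b W1 r A q (f @: S).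
Proof.
move=> cS leC finj fg fedge.
have cfS : #|f @: S| = s2.+1 by rewrite card_in_imset.
have sE : s = s1.-1 + s2.+1 by rewrite /s (cardT_W1 W1) -/s1 -/s2 addnS -addSn prednK.
have lefS : #|f @: S| <= s by rewrite cfS sE leq_addl.
have fSg : f @: S \subset good by apply/subsetP => _ /imsetP[x xS ->]; apply: fg.
have fSA y : y \in f @: S -> y \notin A by move/(subsetP fSg); rewrite !inE => /andP[].
split=> [|A' A'A leA']; first by rewrite lefS cfS.
pose pool := common r (f @: S) A' :&: core.
(* The vertices already spent, those missed by the image of [S], and those outside the core each
   remove at most a quarter of [A]. *)
have cpool : a <= 4 * #|pool|.
  have : #|common r (f @: S) A' :\: core| <= #|A :\: core|.
    apply: subset_leq_card; apply: setSD; apply: subset_trans A'A.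
    by apply/subsetP => y /commonP[].
  move: (cardsID core (common r (f @: S) A')) (card_common_good fSg lefS A'A).
  move: (pool_size A'A leA') qA leC; rewrite -/pool.
  by clear; lia.
have a_gt0 : 0 < a by apply: leq_trans qA; rewrite muln_gt0 addn_gt0 /s1 W1_gt0 orbT.
have [||P [PP cP Pc]] := @clique_in s1.-1 pool _ a_gt0; first exact: subsetIr.
  apply: leq_trans (_ : s1 * a <= _); first by rewrite leq_mul2r leq_pred orbT.
  by rewrite [4 * s1]mulnC -mulnA leq_mul2l cpool orbT.
have PC y : y \in P -> y \in A' /\ {in f @: S, forall p, r p y}.
  by move/(subsetP PP); rewrite inE => /andP[/commonP].
have PA' : P \subset A' by apply/subsetP => y /PC[].
have PA := subset_trans PA' A'A.
have dis : #|f @: S :|: P| = #|f @: S| + #|P|.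
  apply/eqP; rewrite leq_card_setU disjoint_subset; apply/subsetP => y /fSA yA.
  by rewrite inE; apply: contra yA; apply: (subsetP PA).
have [|||g [ginj gG gf]] := @inj_extend _ _ S setT (f @: S :|: P) f finj.
- by move=> x xS; rewrite inE imset_f.
- exact: subsetT.
- by rewrite dis cfS cP cardsT -/s sE addnC.
have gP x : x \notin S -> g x \in P.
  move=> xS; have := gG x (in_setT _); rewrite inE => /orP[/imsetP[y yS eqg]|//].
  case/negP: xS; rewrite -(ginj y x) ?in_setT //; by rewrite gf.
exists g; split.
- split=> [x y|x y bxy]; first by apply: ginj; rewrite in_setT.
  have neq : x != y by apply: contraTneq (bip bxy) => ->; rewrite eqxx.
  have gneq : g x != g y.
    by apply: contra neq => /eqP /ginj -> //; rewrite in_setT.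
  case: (boolP (x \in S)) => xS; case: (boolP (y \in S)) => yS.
  + by rewrite !gf // fedge.
  + by have [_] := PC _ (gP y yS); rewrite (gf x) //; apply; apply: imset_f.
  + by have [_] := PC _ (gP x xS); rewrite (gf y) // rsym; apply; apply: imset_f.
  by apply: Pc => //; apply: gP.
- apply/subsetP => _ /imsetP[x _ ->]; rewrite inE.
  case: (boolP (x \in S)) => xS; first by rewrite gf // imset_f.
  by rewrite (subsetP PA') ?orbT // gP.
rewrite -cP; apply: subset_leq_card; apply/subsetP => y; rewrite inE => /andP[/imsetP[x _ ->]].
case: (boolP (x \in S)) => xS; last by rewrite gP.
by rewrite gf // (negPf (fSA _ (imset_f _ _))).
Qed.

End Units.

(** * Counting edges outside the nearly full vertices *)

Section Counting.
Variables (T V : finType) (b : rel T) (W1 : {set T}) (r : rel V).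
Hypothesis bip : forall x y, b x y -> (x \in W1) != (y \in W1).
Hypothesis rsym : symmetric r.
Hypothesis rirr : irreflexive r.
Hypothesis W1_gt0 : 0 < #|W1|.
Implicit Types (X Y Z : {set V}).

Lemma card_le_codeg X : #|X| <= \sum_(x in X) codeg r x X.
Proof.
rewrite -sum1_card; apply: leq_sum => x xX.
by rewrite /codeg (bigD1 x) //= rirr.
Qed.

Lemma arcs_diag X : arcs r X X + #|X| <= #|X| * #|X|.
Proof. by rewrite -(arcs_codeg r X X) leq_add2l card_le_codeg. Qed.

Lemma arcs_incident X Y thr : Y \subset X -> {in Y, forall y, deg r y X <= thr} ->
  arcs r X X <= 2 * (#|Y| * thr) + arcs r (X :\: Y) (X :\: Y).
Proof.
move=> YX Ydeg; have le := arcs_le Ydeg.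
rewrite (arcs_split rsym YX); move: le; rewrite (arcsIDr rsym Y X Y) (setIidPr YX).
by clear; lia.
Qed.

Lemma sum_codegC X Y : \sum_(x in X) codeg r x Y = \sum_(y in Y) codeg r y X.
Proof.
rewrite /codeg exchange_big; apply: eq_bigr => y _; apply: eq_bigr => x _.
by rewrite rsym.
Qed.

(** [q] is the shortfall of [A] from [s1 * t.+1 - 1] vertices. [exN] and [exZ] stand for ex(N,
    B[s2+1]) and ex(n, B), and [thr] separates high from low degrees outside [A]. *)
Variables (A : {set V}) (q t d thr N exN exZ : nat).
Let s1 := #|W1|.
Let s2 := #|~: W1|.
Let s := #|T|.
Let a := #|A|.
Let n := #|V|.
Let na := #|~: A|.
Let missA := \sum_(x in A) codeg r x A.
Let missV := \sum_(x in ~: A) codeg r x A.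
Local Notation good := (good T r A).
Local Notation core := (core W1 r A).
Hypothesis Adeg : {in A, forall v, codeg r v setT <= d}.
Hypothesis no_packing : ~ packing (hosts b r) t.+1 setT.
Hypothesis le_qt : q <= t.
Hypothesis aE : a + q + 1 = s1 * t.+1.
Hypothesis qA : 4 * (s1.-1 * q + s1) <= a.
Hypothesis room : s1 * d + s * t.+1 + a + s2 <= n.
Hypothesis room_star : s1 * d + s * t.+1 + q.+1 + s2 <= thr.
Hypothesis NE : N + q = na.
Hypothesis thrN : s * thr <= N.
Hypothesis sparse_core : 16 * s1 * (n * s2 + a) <= a * a.
Hypothesis bad_gain : 4 * s * s2 * n + 8 * s * exZ <= a * n.
Hypothesis room_bad : 4 * s * d + a + q + s * q + s2 + 1 <= n.
Hypothesis bound_embed : forall X, s2 < #|X| <= N ->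
  (forall S : {set T}, #|S| = s2.+1 -> ~ embeds_in b r S X) -> arcs r X X <= 2 * exN.
Hypothesis bound_copy : forall X, (forall f, copy b r f -> ~ f @: setT \subset X) ->
  n * arcs r X X <= 4 * #|X| * exZ.
(** The surplus of edges over the claimed number, rewritten for the graph outside [A]: arcs meeting
    [A] are replaced by their missing pairs, and the final [a] compensates for the diagonal counted
    in [missA]. *)
Hypothesis many_arcs :
  na * na + missA + 2 * missV + 2 * exN + 2 + N <= arcs r (~: A) (~: A) + N * N + na + a.

Let s_pos : 0 < s := s_gt0 W1_gt0.

Lemma bad_degree X : X \subset ~: A -> [disjoint X & good] -> #|X| * a <= 4 * s * missV.
Proof.
move=> XA dis; rewrite -sum_nat_const.
apply: leq_trans (_ : \sum_(x in X) 4 * s * codeg r x A <= _).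
  apply: leq_sum => x xX; move/pred0P: dis => /(_ x) /=; rewrite xX inE (subsetP XA) //=.
  by move/negbT; rewrite -ltnNge; apply: ltnW.
rewrite -big_distrr leq_mul2l /=; apply/orP; right.
by rewrite /missV [X in _ <= X](big_setID X) /= (setIidPr XA) leq_addr.
Qed.

(** The missing pairs are counted from both ends: each vertex of [X] misses at least a/(4s) of [A],
    while each vertex of [A] misses at most [d] vertices. *)
Lemma card_bad X : X \subset ~: A -> [disjoint X & good] -> #|X| <= 4 * s * d.
Proof.
move=> XA dis; have := bad_degree XA dis.
have : missV <= a * d.
  rewrite /missV sum_codegC -sum_nat_const; apply: leq_sum => x xA.
  by apply: leq_trans (Adeg xA); apply: codegS.
have a_gt0 : 0 < a.
  by apply: leq_trans qA; rewrite muln_gt0 addn_gt0 /s1 W1_gt0 orbT.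
move=> le1 le2; rewrite -(leq_pmul2r a_gt0); apply: leq_trans le2 _.
by rewrite -[4 * s * d * a]mulnA (mulnC d) leq_mul2l le1 orbT.
Qed.

(** More than a quarter of [A] lies outside the core, and each such vertex misses more than a/(4 s1)
    of [A]; [sparse_core] compares the product with the claim. *)
Lemma core_defect : ~~ (4 * #|A :\: core| <= a) -> n * s2 + a <= missA.
Proof.
rewrite -ltnNge => /ltnW ltC.
have s1_gt0 : 0 < 16 * s1 by rewrite muln_gt0.
rewrite -(leq_pmul2l s1_gt0); apply: leq_trans sparse_core _.
apply: leq_trans (_ : 4 * #|A :\: core| * a <= _); first by rewrite leq_mul2r ltC orbT.
suff : #|A :\: core| * a <= 4 * s1 * missA by clear; lia.
apply: leq_trans (_ : \sum_(x in A :\: core) 4 * s1 * codeg r x A <= _).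
  rewrite -sum_nat_const; apply: leq_sum => x; rewrite !inE => /andP[+ xA]; rewrite xA /=.
  by rewrite -ltnNge; apply: ltnW.
rewrite -big_distrr leq_mul2l /=; apply/orP; right; rewrite /missA [X in _ <= X](big_setID core) /=; exact: leq_addl.
Qed.

Lemma counting_contradiction : False.
Proof.
pose H := [set x in ~: A | thr <= deg r x (~: A)].
have Hdeg : {in H, forall x, thr <= deg r x (~: A)} by move=> x; rewrite inE => /andP[].
have HA : H \subset ~: A by apply/subsetP => x; rewrite inE => /andP[].
have Hlow x : x \notin A -> x \notin H -> deg r x (~: A) <= thr.
  by move=> xA; rewrite !inE xA /= -ltnNge; apply: ltnW.
clearbody H.
have disAH : [disjoint A & H] by rewrite disjoint_sym disjoints_subset.
have MT k : k = t.+1 -> #|~: ([set: V])| + #|T| * k <= s * t.+1.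
  by move=> ->; rewrite setCT cards0.
(* Otherwise [q.+1] stars and [t - q] full copies would form a packing; they need (s1-1)(q+1) +
   s1(t-q) = s1(t+1) - q - 1 vertices of [A], which is exactly [a]. *)
have leH : #|H| <= q.
  rewrite leqNgt; apply/negP => /subset_card_eq[H0 H0H cH0]; apply: no_packing.
  have -> : t.+1 = q.+1 + (t - q) by move: le_qt; clear; lia.
  apply: (packing_star bip rsym W1_gt0 (A := A) (H := H0) (A' := A) (H' := H0) Adeg room (thr := thr)) => //.
  - by rewrite cH0.
  - by move=> x /(subsetP H0H)/Hdeg.
  - by apply: disjointWr disAH.
  - by rewrite setIT.
  - by rewrite setIT.
  - move: aE W1_gt0 le_qt; rewrite -/s1 -/a; case: s1 => // z + _ le; rewrite /= -{1}(subnKC le).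
    by move: (t - q) => w; clear; rewrite !mulSn !mulnS mulnDr; lia.
  by apply: MT; move: le_qt; clear; lia.
pose h := #|H|; pose j := q - h.
have qE : q = h + j by rewrite subnKC.
pose X := ~: A :\: H.
have cX : #|X| + h = na by rewrite /na -(cardsID H (~: A)) (setIidPr HA) addnC.
have naE : a + na = n by apply: cardsC.
have XA : X \subset ~: A by apply: subsetDl.
(* The same budget with [j.+1] units and [h] stars in place of [q.+1] stars rules out [j.+1]
   disjoint units in [X]. *)
have [|||pk|[Y [YX lejY leYj noU]]] := @maximal_packing V (unit_at b W1 r A q) s j X.
- by move=> Y [].
- move: room_bad cX naE qE; rewrite -/h; clear -s; move=> + + + qE; rewrite qE mulnDr.
  by move: (s * h) (s * j) (4 * s * d) => x y z; clear; lia.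
- exact: s_pos.
- apply: no_packing.
  have -> : t.+1 = j.+1 + h + (t - q) by move: le_qt qE; clear; lia.
  apply: (packing_units bip rsym W1_gt0 (A := A) (H := H) (A' := A) (H' := H) (X := X) Adeg room (thr := thr)) pk _ _ _ _ _ _ _ _ => //.
  + by move: room_star leH; clear; lia.
  + by rewrite disjoint_subset; apply/subsetP => x; rewrite !inE negb_or andbC.
  + by rewrite setIT.
  + by rewrite setIT.
  + move: aE W1_gt0 le_qt; rewrite -/s1 -/a addSn [j + h]addnC -qE; case: s1 => // z + _ le; rewrite /= -{1}(subnKC le).
    by move: (t - q) => w; clear; rewrite !mulSn !mulnS mulnDr; lia.
  + rewrite setDv cards0 add0n leq_mul2l ltnS qE leq_addl orbT //.
  by apply: MT; move: le_qt qE; clear; lia.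
pose R := X :\: Y.
have cR : #|R| + #|Y| = #|X| by rewrite -(cardsID Y X) (setIidPr YX) addnC.
pose G := R :&: good; pose Z := R :\: good.
have RA : R \subset ~: A by apply: subset_trans XA; apply: subsetDl.
have GR : G \subset R by apply: subsetIl.
have Gg : G \subset good by apply: subsetIr.
have ZR : Z \subset R by apply: subsetDl.
have ZE : R :\: G = Z by rewrite /G setDIr setDv set0U.
have cGZ : #|G| + #|Z| = #|R| by rewrite cardsID.
have leZ : #|Z| <= 4 * s * d.
  apply: card_bad; first exact: subset_trans RA.
  by rewrite -setI_eq0 setIDAC -setIDA setDv setI0.
have Rdeg x : x \in R -> deg r x G <= s2.
  move=> xR; rewrite leqNgt; apply/negP; rewrite deg_card => /ltnW /subset_card_eq[Q QG cQ].
  have QG' : Q \subset G by apply: subset_trans QG _; apply/subsetP => y; rewrite inE => /andP[].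
  apply: (noU (x |: Q)).
    by rewrite subUset sub1set xR (subset_trans QG').
  apply: unit_star => //; first by have := subsetP RA x xR; rewrite inE.
    exact: subset_trans Gg.
  by move=> y /(subsetP QG); rewrite inE => /andP[].
(* With a large core, any member of B[s2+1] in [G] would be a unit. With a small core, [G] has
   degrees at most [s2], and the pairs missing inside [A] outweigh all its arcs. *)
have GG : arcs r G G + a <= 2 * exN + missA.
  have leA : a <= missA by apply: card_le_codeg.
  case: (boolP (4 * #|A :\: core| <= a)) => [okC|/core_defect]; last first.
    have : arcs r G G <= n * s2.
      apply: leq_trans (_ : #|G| * s2 <= _); last by rewrite leq_mul2r max_card orbT.
      by apply: arcs_le => x xG; apply: Rdeg; apply: (subsetP GR).
    by clear; lia.
  suff : arcs r G G <= 2 * exN by move: leA; clear; lia.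
  apply: bound_embed.
    apply/andP; split.
      have lesj : s * j <= s * q by rewrite leq_mul2l leq_subr orbT.
      move: room_bad leZ cGZ cR cX naE leYj leH lesj; rewrite -/h.
      by move: (4 * s * d) (s * j) (s * q) => x y z; clear; lia.
    by move: NE cGZ cR cX lejY qE; rewrite -/h; clear; lia.
  move=> S cS [f [finj fG fedge]]; apply: (noU (f @: S)).
    by apply: subset_trans GR; apply/subsetP => _ /imsetP[x xS ->]; apply: fG.
  apply: unit_embedding => // x /fG; exact: (subsetP Gg).
have ZZ : n * arcs r Z Z <= 4 * #|Z| * exZ.
  apply: bound_copy => f fc fZ; apply: (noU (f @: setT)); first exact: subset_trans ZR.
  by apply: unit_copy => //; apply: subset_trans fZ (subset_trans ZR RA).
have ZG : arcs r G Z <= #|Z| * s2.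
  by rewrite (arcsC rsym); apply: arcs_le => x /(subsetP ZR); apply: Rdeg.
(* Every vertex of [Z] misses a fixed proportion of [A]; by [bad_gain] this exceeds its share of the
   arcs to [G] and of the arcs inside the B-free set [Z]. *)
have gain : 2 * (#|Z| * s2) + arcs r Z Z <= 2 * missV.
  have n_gt0 : 0 < n by move: room_bad; clear; lia.
  have := bad_degree (subset_trans ZR RA) _; rewrite -setI_eq0 setIDAC -setIDA setDv setI0 eqxx => /(_ isT) le1.
  rewrite -(leq_pmul2l (_ : 0 < 2 * s * n)) ?muln_gt0 ?n_gt0 ?s_pos //.
  apply: leq_trans (_ : #|Z| * (a * n) <= _); last first.
    by move: (leq_mul le1 (leqnn n)); clear; lia.
  apply: leq_trans (_ : #|Z| * (4 * s * s2 * n + 8 * s * exZ) <= _); last first.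
    by rewrite leq_mul2l bad_gain orbT.
  by move: (leq_mul (leqnn (2 * s)) ZZ); clear; lia.
have RR : arcs r R R <= 2 * exN + missA - a + 2 * missV.
  rewrite (arcs_split rsym GR) ZE; move: GG ZG gain; clear; lia.
have XX : arcs r X X <= 2 * (s * j * thr) + arcs r R R.
  apply: leq_trans (arcs_incident (thr := thr) YX _) _.
    move=> y /(subsetP YX); rewrite !inE => /andP[yH yA].
    by apply: leq_trans (Hlow y yA yH); apply: degS.
  by rewrite leq_add2r leq_mul2l leq_mul2r leYj orbT.
have VV : arcs r (~: A) (~: A) + h <= h * h + 2 * (h * #|X|) + arcs r X X.
  rewrite (arcs_split rsym HA); move: (arcs_diag H) (arcs_le_card r H X).
  by rewrite -/h -/X; clear; lia.
(* Deleting the at most [s * j] vertices of [Y], all of low degree, costs no more than [j] vertices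
   joined to [N] others. *)
have YN : s * j * thr <= j * N by rewrite mulnAC mulnC leq_mul2l thrN orbT.
have leA : a <= missA by apply: card_le_codeg.
have XE : #|X| = N + j by move: NE cX qE; clear; lia.
have nE : na = N + j + h by move: NE qE; clear; lia.
(* With [na = N + j + h] all terms of the final inequality cancel except [j * j + 2 <= j]. *)
have jj : j <= j * j by case: (j) => // z; rewrite leq_pmulr.
move: many_arcs VV XX RR YN leA jj; rewrite nE XE; clear; nia.
Qed.

End Counting.

(** * Edge sets and extremal numbers *)

Section Edges.
Variables (V : finType) (E : {set {set V}}).
Hypothesis simpleE : simple_graph E.

Lemma edge_card e : e \in E -> #|e| = 2.
Proof. by move/forall_inP: simpleE => h /h /eqP. Qed.

Lemma adj_sym : symmetric (adj E).
Proof. by move=> x y; rewrite /adj setUC. Qed.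

Lemma adj_irr : irreflexive (adj E).
Proof.
by move=> x; apply/negP; rewrite /adj setUid => /edge_card; rewrite cards1.
Qed.

Lemma edgeP e : e \in E -> exists x y, [/\ x != y, e = [set x; y] & adj E x y].
Proof.
move=> eE; have /eqP/cards2P[x [y [neq eq]]] := edge_card eE.
by exists x, y; rewrite /adj -eq.
Qed.

Lemma pair_count (e : {set V}) : #|e| = 2 ->
  \sum_x \sum_y ([set x; y] == e) = 2.
Proof.
move/eqP/cards2P => [u [v [neq ->]]].
transitivity (\sum_(p : V * V | [set p.1; p.2] == [set u; v]) 1).
  by rewrite pair_bigA [RHS]big_mkcond.
rewrite sum1dep_card.
transitivity #|[set (u, v); (v, u)]|; last by rewrite cards2 xpair_eqE negb_and neq.
apply: eq_card => -[x y]; rewrite 4!inE !xpair_eqE /=; apply/eqP/idP.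
  move=> eqs; have xin : x \in [set u; v] by rewrite -eqs set21.
  have yin : y \in [set u; v] by rewrite -eqs set22.
  have := cards2 x y; rewrite eqs cards2 neq; case: (eqVneq x y) => // nxy _.
  by move: xin yin nxy; rewrite !inE => /orP[] /eqP-> /orP[] /eqP->; rewrite ?eqxx ?orbT.
by case/orP => /andP[/eqP-> /eqP->] //; rewrite setUC.
Qed.

Definition edges_in (W : {set V}) : {set {set V}} := [set e in E | e \subset W].

Lemma arcs_edges (W : {set V}) : arcs (adj E) W W = 2 * #|edges_in W|.
Proof.
transitivity (\sum_x \sum_y \sum_(e in edges_in W) ([set x; y] == e)).
  rewrite /arcs /deg big_mkcond; apply: eq_bigr => x _.
  rewrite [in RHS](eq_bigr (fun y => ([set x; y] \in edges_in W) : nat)).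
    rewrite big_mkcond /=; case: ifP => xW.
      apply: eq_bigr => y _; rewrite inE subUset !sub1set xW /adj /=.
      by case: ifP; rewrite ?andbT ?andbF.
    by rewrite big1 // => y _; rewrite inE subUset !sub1set xW andbF.
  move=> y _; case: (boolP (_ \in _)) => [xyE|xyE].
    by rewrite (bigD1 _ xyE) /= eqxx big1 // => e /andP[_ /negPf]; rewrite eq_sym => ->.
  by rewrite big1 // => e eE; case: eqP => // xye; rewrite xye eE in xyE.
under eq_bigr => x _ do rewrite exchange_big /=.
rewrite exchange_big /=.
rewrite (eq_bigr (fun=> 2)) ?sum_nat_const 1?mulnC // => e; rewrite inE => /andP[eE _].
by apply: pair_count; apply: edge_card.
Qed.

Lemma edges_inT : edges_in setT = E.
Proof. by apply/setP=> e; rewrite inE subsetT andbT. Qed.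

End Edges.

Lemma embeds_onP (T1 T2 : finType) (S : {set T1}) (F : {set {set T1}}) (G : {set {set T2}}) :
  simple_graph F ->
  reflect (exists f : T1 -> T2, {in S &, injective f} /\
             {in S &, forall x y, adj F x y -> adj G (f x) (f y)})
          (embeds_on S F G).
Proof.
move=> sF; apply: (iffP existsP) => [[f /andP[/forall_inP finj /forall_inP fe]]|[f [finj fe]]].
  exists f; split.
    by move=> x y xS yS eqf; move/forall_inP: (finj x xS) => /(_ y yS); rewrite eqf eqxx => /eqP.
  move=> x y xS yS xy; have := fe _ xy; rewrite subUset !sub1set xS yS /=.
  by rewrite imsetU1 imset_set1.
exists [ffun x => f x]; apply/andP; split.
  apply/forall_inP => x xS; apply/forall_inP => y yS; rewrite !ffunE.
  by apply/implyP => /eqP /finj->.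
apply/forall_inP => e /(edgeP sF)[x [y [_ -> xy]]].
rewrite subUset !sub1set; apply/implyP => /andP[xS yS].
by rewrite imsetU1 imset_set1 !ffunE; apply: fe.
Qed.

Lemma containsP (T1 T2 : finType) (F : {set {set T1}}) (G : {set {set T2}}) :
  simple_graph F ->
  reflect (exists f : T1 -> T2, copy (adj F) (adj G) f) (contains F G).
Proof.
move=> sF; apply: (iffP (embeds_onP _ _ sF)) => -[f [finj fe]]; exists f; split.
- by move=> x y; apply: finj; rewrite inE.
- by move=> x y; apply: fe; rewrite inE.
- by move=> x y _ _; apply: finj.
by move=> x y _ _; apply: fe.
Qed.

Lemma ex_ge n bad (E : {set {set 'I_n}}) :
  simple_graph E -> ~~ bad E -> #|E| <= ex n bad.
Proof.
by move=> sE nbad; rewrite /ex (bigmax_sup E) // sE.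
Qed.

Lemma ex_le n bad m : (forall E : {set {set 'I_n}}, simple_graph E -> ~~ bad E -> #|E| <= m) ->
  ex n bad <= m.
Proof. by move=> h; apply/bigmax_leqP => E /andP[]; apply: h. Qed.

Lemma ex_attained n bad : ~~ bad (set0 : {set {set 'I_n}}) ->
  exists E : {set {set 'I_n}}, [/\ simple_graph E, ~~ bad E & #|E| = ex n bad].
Proof.
move=> n0; have [|E /andP[sE nE] eqE] :=
  @eq_bigmax_cond _ (fun E : {set {set 'I_n}} => simple_graph E && ~~ bad E) (fun E => #|E|).
  by apply/card_gt0P; exists set0; rewrite unfold_in n0 andbT; apply/forall_inP => e; rewrite inE.
by exists E.
Qed.

(** * Moving subgraphs to and from the vertex sets of the extremal numbers *)

Section Transport.
Variables (T : finType) (B : {set {set T}}).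
Hypothesis simpleB : simple_graph B.

(* Vertices that the embedding places outside the copy of W are isolated in the
   pattern, so they can be moved inside. *)
Lemma pull_back (V : finType) (E : {set {set V}}) (W : {set V}) N (g : V -> 'I_N)
    (S : {set T}) (v0 : V) :
  {in W &, injective g} ->
  (#|S| <= #|W| \/ {in S, forall x, exists2 y, y \in S & adj B x y}) ->
  embeds_on S B [set g @: (e : {set V}) | e in edges_in E W] ->
  embeds_in (adj B) (adj E) S W.
Proof.
set E' := [set _ | _ in _] => ginj small /(embeds_onP _ _ simpleB)[f [finj fe]].
pose S0 := [set x in S | f x \in g @: W].
have S0S : S0 \subset S by apply/subsetP => x; rewrite inE => /andP[].
pose h x := odflt v0 [pick w in W | g w == f x].
have hP x : x \in S0 -> h x \in W /\ g (h x) = f x.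
  rewrite inE => /andP[_ /imsetP[w wW fw]]; rewrite /h; case: pickP => [w' /andP[w'W /eqP]|] //.
  by move/(_ w); rewrite wW fw eqxx.
have fedge x y : x \in S -> y \in S -> adj B x y ->
    [/\ x \in S0, y \in S0 & adj E (h x) (h y)].
  move=> xS yS xy; have /imsetP[e + eqe] := fe x y xS yS xy; rewrite inE => /andP[eE eW].
  have sub z : z \in [set f x; f y] -> z \in g @: W.
    by rewrite eqe => /imsetP[w we ->]; apply: imset_f; apply: (subsetP eW).
  have x0 : x \in S0 by rewrite inE xS sub // !inE eqxx.
  have y0 : y \in S0 by rewrite inE yS sub // !inE eqxx orbT.
  split=> //; rewrite /adj; have [hxW hx] := hP x x0; have [hyW hy] := hP y y0.
  suff -> : [set h x; h y] = e by [].
  have : g @: [set h x; h y] = g @: e by rewrite imsetU1 imset_set1 hx hy.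
  have hW : [set h x; h y] \subset W by rewrite subUset !sub1set hxW.
  move=> eqg; apply/setP => z; apply/idP/idP => zin.
    have /imsetP[w we gz] : g z \in g @: e by rewrite -eqg imset_f.
    by rewrite (ginj z w (subsetP hW z zin) (subsetP eW w we) gz).
  have /imsetP[w we gz] : g z \in g @: [set h x; h y] by rewrite eqg imset_f.
  by rewrite (ginj z w (subsetP eW z zin) (subsetP hW w we) gz).
have leSW : #|S| <= #|W|.
  case: small => // nb; rewrite -(card_in_imset finj) -(card_in_imset ginj).
  apply: subset_leq_card; apply/subsetP => _ /imsetP[x xS ->].
  by have [y yS xy] := nb x xS; have [] := fedge x y xS yS xy; rewrite inE => /andP[].
have [||h' [h'inj h'W h'h]] := @inj_extend _ _ S0 S W h _ _ S0S leSW.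
- move=> x y x0 y0 eqh; apply: finj; rewrite ?(subsetP S0S) //.
  by have [_ <-] := hP x x0; have [_ <-] := hP y y0; rewrite eqh.
- by move=> x /hP[].
exists h'; split=> // x y xS yS xy; have [x0 y0 E0] := fedge x y xS yS xy.
by rewrite !h'h.
Qed.

(** [W] is injected into ['I_N]; the vertices of ['I_N] outside its image are isolated padding. *)
Lemma push_edges (V : finType) (E : {set {set V}}) (W : {set V}) N : 0 < N ->
  simple_graph E -> #|W| <= N ->
  exists g : V -> 'I_N,
    [/\ {in W &, injective g}, simple_graph [set g @: (e : {set V}) | e in edges_in E W] &
        #|[set g @: (e : {set V}) | e in edges_in E W]| = #|edges_in E W|].
Proof.
move=> N_gt0 sE leWN.
have [||||g [ginj _ _]] := @inj_extend V 'I_N set0 W setT (fun=> Ordinal N_gt0).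
- by move=> x; rewrite inE.
- by move=> x; rewrite inE.
- exact: sub0set.
- by rewrite cardsT card_ord.
have sub e : e \in edges_in E W -> e \subset W by rewrite inE => /andP[].
exists g; split=> //.
  apply/forall_inP => _ /imsetP[e eE ->]; rewrite card_in_imset.
    by rewrite (edge_card sE) //; move: eE; rewrite inE => /andP[].
  by move=> x y /(subsetP (sub e eE)) xW /(subsetP (sub e eE)) yW; apply: ginj.
apply: card_in_imset => e1 e2 /sub W1 /sub W2 eqg; apply/setP => z; apply/idP/idP => zin.
  have /imsetP[w we gz] : g z \in g @: e2 by rewrite -eqg imset_f.
  by rewrite (ginj z w (subsetP W1 z zin) (subsetP W2 w we) gz).
have /imsetP[w we gz] : g z \in g @: e1 by rewrite eqg imset_f.
by rewrite (ginj z w (subsetP W2 z zin) (subsetP W1 w we) gz).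
Qed.

Lemma arcs_ex_induced (V : finType) (E : {set {set V}}) (W : {set V}) N k (v0 : V) :
  simple_graph E -> k <= #|W| <= N ->
  (forall S : {set T}, #|S| = k -> ~ embeds_in (adj B) (adj E) S W) ->
  arcs (adj E) W W <= 2 * ex N (contains_induced_k B k).
Proof.
move=> sE /andP[lek leN] no; rewrite arcs_edges // leq_mul2l /=.
(* For [N = 0] there is no map into ['I_N], but then [W] is empty. *)
case: (posnP N) => [N0|N_gt0].
  have W0 : W = set0 by apply/eqP; rewrite -cards_eq0 -leqn0 -N0.
  rewrite (_ : edges_in E W = set0) ?cards0 //; apply/setP => e; rewrite !inE W0 subset0.
  by apply/andP => -[/(edge_card sE) + /eqP e0]; rewrite e0 cards0.
have [g [ginj sE' <-]] := push_edges N_gt0 sE leN.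
apply: ex_ge => //; apply/existsP => -[S /andP[/eqP cS /(pull_back v0 ginj) emb]].
by apply: (no S cS); apply: emb; left; rewrite cS.
Qed.

Lemma arcs_ex_contains (V : finType) (E : {set {set V}}) (W : {set V}) (v0 : V) :
  simple_graph E -> (forall x, exists y, adj B x y) ->
  (forall f, copy (adj B) (adj E) f -> ~ f @: setT \subset W) -> 0 < #|W| ->
  arcs (adj E) W W <= 2 * ex #|W| (contains B).
Proof.
move=> sE nb no W_gt0; rewrite arcs_edges // leq_mul2l /=.
have [g [ginj sE' <-]] := push_edges W_gt0 sE (leqnn _).
apply: ex_ge => //; apply/negP => /(pull_back v0 ginj) [].
  by right=> x _; have [y xy] := nb x; exists y; rewrite ?inE.
move=> f [finj fW fe]; apply: (no f).
  split=> [x y|x y]; first by apply: finj; rewrite inE.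
  by apply: fe; rewrite inE.
by apply/subsetP => _ /imsetP[x _ ->]; apply: fW; rewrite inE.
Qed.

End Transport.

Lemma connect_const (T : finType) (T' : Type) (e : rel T) (g : T -> T') x y :
  (forall u v, e u v -> g u = g v) -> connect e x y -> g x = g y.
Proof.
move=> ge /connectP[p + ->]; elim: p x => //= z p IH x /andP[exz /IH <-].
exact: ge.
Qed.

Lemma connected_neighbor (T : finType) (B : {set {set T}}) : 1 < #|T| ->
  connected_graph B -> forall x, exists y, adj B x y.
Proof.
move=> T_gt1 conn x; have [y neq] : exists y, y != x.
  have : 0 < #|[set~ x]| by rewrite cardsC1; case: #|T| T_gt1 => // -[].
  by case/card_gt0P => y; rewrite !inE; exists y.
case/connectP: (conn x y) => [[|z p] /=]; first by move=> _ eqy; rewrite eqy eqxx in neq.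
by case/andP; exists z.
Qed.

(** * Comparing extremal numbers of different orders *)

Section BlowUp.
Variables (T : finType) (B : {set {set T}}).
Hypothesis simpleB : simple_graph B.
Hypothesis connB : connected_graph B.
Hypothesis T_gt1 : 1 < #|T|.

Lemma not_contains0 n : ~~ contains B (set0 : {set {set 'I_n}}).
Proof.
apply/negP => /(containsP _ simpleB)[f [_ fe]].
have /card_gt0P[x _] : 0 < #|T| by apply: ltnW.
have [y xy] := connected_neighbor T_gt1 connB x.
by have := fe x y xy; rewrite /adj inE.
Qed.

(* n %/ z disjoint translates of a B-free graph on z vertices stay B-free
   because B is connected. *)
Lemma ex_blow_up z n : 0 < z -> 0 < n ->
  n %/ z * ex z (contains B) <= ex n (contains B).
Proof.
move=> z_gt0 n_gt0.
have [F [sF nF <-]] := ex_attained (not_contains0 z).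
(* The [k]-th block of [z] consecutive vertices. For [k < n %/ z] the value lies below [n], so the
   default of [insubd] is never taken; division and remainder by [z] recover block and position. *)
pose phi (k : nat) (i : 'I_z) : 'I_n := insubd (Ordinal n_gt0) (k * z + i).
have phiE (k : 'I_(n %/ z)) i : phi k i = k * z + i :> nat.
  rewrite val_insubd; case: ifP => // /negbT; rewrite -leqNgt => le.
  have : k.+1 * z <= n by apply: leq_trans (leq_trunc_div n z); rewrite leq_mul2r ltn_ord orbT.
  by move: (ltn_ord i) le; rewrite mulSn; clear; lia.
have phi_div (k : 'I_(n %/ z)) i : phi k i %/ z = k.
  by rewrite phiE divnMDl // (divn_small (ltn_ord i)) addn0.
have phi_mod (k : 'I_(n %/ z)) i : phi k i %% z = i.
  by rewrite phiE modnMDl (modn_small (ltn_ord i)).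
have phi_inj (k : 'I_(n %/ z)) : injective (phi k).
  by move=> i j eqf; apply: val_inj; rewrite /= -(phi_mod k i) eqf phi_mod.
pose E' := [set phi p.1 @: (p.2 : {set 'I_z}) | p : 'I_(n %/ z) * {set 'I_z} in setX [set: 'I_(n %/ z)] F].
have cE' : #|E'| = n %/ z * #|F|.
  rewrite card_in_imset; first by rewrite cardsX cardsT card_ord.
  move=> [k e] [k' e'] /=; rewrite !inE /= => eF e'F eqp.
  have [x [y [_ ex _]]] := edgeP sF eF.
  have /imsetP[x' _ eqx] : phi k x \in phi k' @: e' by rewrite -eqp imset_f // ex set21.
  have kk' : k = k' by apply: val_inj; rewrite /= -(phi_div k x) eqx phi_div.
  by congr pair => //; apply: (imset_inj (@phi_inj k')); rewrite -eqp kk'.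
rewrite -cE'; apply: ex_ge.
  apply/forall_inP => _ /imsetP[[k e] + ->]; rewrite !inE /= => eF.
  by rewrite card_imset // (edge_card sF).
pose psi (u : 'I_n) : 'I_z := Ordinal (ltn_pmod u z_gt0).
have adjE u v : u != v -> adj E' u v -> u %/ z = v %/ z /\ adj F (psi u) (psi v).
  move=> neq /imsetP[[k e]]; rewrite !inE /= => eF eqe.
  have /imsetP[x1 x1e eu] : u \in phi k @: e by rewrite -eqe set21.
  have /imsetP[x2 x2e ev] : v \in phi k @: e by rewrite -eqe set22.
  rewrite eu ev !phi_div; split=> //.
  have -> : psi (phi k x1) = x1 by apply: val_inj; rewrite /= phi_mod.
  have -> : psi (phi k x2) = x2 by apply: val_inj; rewrite /= phi_mod.
  rewrite /adj (_ : [set x1; x2] = e) //; apply/eqP.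
  rewrite eqEcard subUset !sub1set x1e x2e (edge_card sF eF) cards2 /=.
  by rewrite (_ : x1 != x2) //; apply: contra neq => /eqP eq12; rewrite eu ev eq12.
apply/negP => /(containsP _ simpleB)[f [finj fe]].
have fadj x y : adj B x y -> f x %/ z = f y %/ z /\ adj F (psi (f x)) (psi (f y)).
  move=> xy; apply: adjE (fe x y xy); apply: contraTneq xy => /finj ->.
  by rewrite adj_irr.
(* A connected pattern stays in one block, so reduction modulo [z] is injective on its image and
   yields a copy in [F]. *)
case/negP: nF; apply/(containsP _ simpleB); exists (fun x => psi (f x)); split.
  move=> x y /(congr1 val) /= eqm; apply: finj; apply: val_inj => /=.
  rewrite (divn_eq (f x) z) [RHS](divn_eq (f y) z) eqm; congr (_ * _ + _).
  by apply: (connect_const (g := fun x => f x %/ z) _ (connB x y)) => u v /fadj[].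
by move=> x y /fadj[].
Qed.

(** Repeating an extremal graph on [#|W|] vertices bounds the density of a B-free graph on [W] by
    that of ex(n, B); rounding in [n %/ #|W|] costs a factor 2, and ordered pairs another. *)
Lemma arcs_copy_free n (E : {set {set 'I_n}}) (W : {set 'I_n}) :
  simple_graph E -> (forall f, copy (adj B) (adj E) f -> ~ f @: setT \subset W) ->
  n * arcs (adj E) W W <= 4 * #|W| * ex n (contains B).
Proof.
move=> sE no; case: (posnP #|W|) => [W0|W_gt0].
  have := arcs_le_card (adj E) W W; rewrite W0 mul0n leqn0 => /eqP->.
  by rewrite muln0.
have /card_gt0P[v0 _] := W_gt0.
have leWn : #|W| <= n by rewrite -[n in _ <= n]card_ord max_card.
have n_gt0 := leq_trans W_gt0 leWn.
have := arcs_ex_contains simpleB v0 sE (connected_neighbor T_gt1 connB) no W_gt0.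
have := ex_blow_up W_gt0 n_gt0; move: (ex #|W| _) (ex n _) (arcs _ W W) => x y u.
have : n <= 2 * (n %/ #|W| * #|W|).
  rewrite {1}(divn_eq n #|W|) mul2n -addnn leq_add2l; apply: ltnW.
  by apply: leq_trans (ltn_pmod n W_gt0) _; rewrite leq_pmull // divn_gt0.
move: (n %/ #|W|) => k le1 le2 le3.
apply: leq_trans (leq_mul le1 le3) _.
by move: (leq_mul (leqnn #|W|) le2); clear; lia.
Qed.

End BlowUp.

(** * Packings as embeddings of disjoint copies *)

Section Disjoint.
Variables (T : finType) (B : {set {set T}}).
Hypothesis simpleB : simple_graph B.

Lemma simple_disj_copies m : simple_graph (disj_copies m B).
Proof.
apply/forall_inP => _ /imset2P[i e _ eB ->].
by rewrite card_imset ?(edge_card simpleB) // => x y [].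
Qed.

Lemma disj_copies_adj m (i : 'I_m) (x y : T) :
  adj B x y -> adj (disj_copies m B) (i, x) (i, y).
Proof.
move=> xy; apply/imset2P; exists i [set x; y] => //.
by rewrite imsetU1 imset_set1.
Qed.

(** Indexing by [nat] lets the recursion prepend a copy by shifting; values from index [k] on are
    arbitrary. *)
Lemma packing_family (V : finType) (r : rel V) k (W : {set V}) (v0 : V) :
  packing (hosts (adj B) r) k W ->
  exists F : nat -> T -> V,
    [/\ forall i, i < k -> copy (adj B) r (F i),
        forall i x, i < k -> F i x \in W &
        forall i j x y, i < k -> j < k -> F i x = F j y -> i = j].
Proof.
elim: k W => [|k IH] W /=; first by move=> _; exists (fun _ _ => v0).
move=> [Y [[f fc fY] YW /IH[F [Fc FW Fd]]]].
have fin x : f x \in Y by rewrite -fY imset_f.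
have FY i x : i < k -> F i x \notin Y by move=> /(FW i x); rewrite inE => /andP[].
exists (fun i => if i is i'.+1 then F i' else f); split.
- by case=> [|i] //; apply: Fc.
- case=> [|i] x lti; first by apply: (subsetP YW).
  by have := FW i x lti; rewrite inE => /andP[].
move=> [|i] [|j] x y //= lti ltj eqf.
- by have := FY j y ltj; rewrite -eqf fin.
- by have := FY i x lti; rewrite eqf fin.
by rewrite (Fd i j x y).
Qed.

Lemma packing_contains (V : finType) (E : {set {set V}}) k (v0 : V) :
  packing (hosts (adj B) (adj E)) k setT -> contains (disj_copies k B) E.
Proof.
move=> /(packing_family v0)[F [Fc _ Fd]].
apply/existsP; exists [ffun p => F (val p.1) p.2]; apply/andP; split.
  apply/forall_inP => -[i x] _; apply/forall_inP => -[j y] _; rewrite !ffunE /=.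
  apply/implyP => /eqP eqF; have eij := Fd i j x y (ltn_ord i) (ltn_ord j) eqF.
  have [Finj _] := Fc i (ltn_ord i).
  rewrite -eij in eqF; rewrite (Finj _ _ eqF); apply/eqP; congr pair; exact: val_inj.
apply/forall_inP => _ /imset2P[i e _ eB ->]; rewrite subsetT /=.
have [x [y [_ -> xy]]] := edgeP simpleB eB.
rewrite imsetU1 imset_set1 imsetU1 imset_set1 !ffunE /=.
by have [_] := Fc i (ltn_ord i); apply.
Qed.

End Disjoint.

Lemma cover_numberE (T : finType) (B : {set {set T}}) (A : {set T}) :
  vertex_cover B A -> cover_number B <= #|A|.
Proof.
rewrite /cover_number => cov; have := mem_index_enum A.
elim: (index_enum _) => // C l IH; rewrite inE big_cons => /orP[/eqP<-|/IH le].
  by rewrite cov geq_minl.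
by case: ifP => // _; apply: leq_trans le; apply: geq_minr.
Qed.

(** * The two bounds *)

Section LowerBound.
Variables (T : finType) (B : {set {set T}}) (W1 : {set T}).
Hypothesis simpleB : simple_graph B.
Hypothesis W1_gt0 : 0 < #|W1|.
Hypothesis coverB : cover_number B = #|W1|.
Let s1 := #|W1|.
Let s2 := #|~: W1|.

(** An independent set of [s2.+1] pattern vertices would have a vertex cover of size [s1 - 1] as
    complement. Hence the edgeless graph is admissible and the extremal number is attained. *)
Lemma not_contains_induced0 n : ~~ contains_induced_k B s2.+1 (set0 : {set {set 'I_n}}).
Proof.
apply/negP => /existsP[S /andP[/eqP cS /(embeds_onP _ _ simpleB)[f [_ fe]]]].
have cov : vertex_cover B (~: S).
  apply/forall_inP => e eB; have [x [y [_ -> xy]]] := edgeP simpleB eB.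
  apply/negP => /eqP/setP e0; have xS : x \in S.
    by have := e0 x; rewrite !inE eqxx => /negbFE.
  have yS : y \in S by have := e0 y; rewrite !inE eqxx orbT => /negbFE.
  by have := fe x y xS yS xy; rewrite /adj inE.
have := cover_numberE cov; rewrite coverB.
move: (cardsC S) (cardsC W1) W1_gt0; rewrite cS /s2; clear; lia.
Qed.

Lemma ex_disj_copies_ge n t N : 0 < N -> n + 1 = N + s1 * t.+1 -> 
  'C(n, 2) - 'C(N, 2) + ex N (contains_induced_k B s2.+1)
    <= ex n (contains (disj_copies t.+1 B)).
Proof.
move=> N_gt0 nE; have [F [sF nF <-]] := ex_attained (not_contains_induced0 N).
have leNn : N <= n by move: nE; rewrite mulnS /s1; move: W1_gt0 (_ * t); clear; lia.
pose low : 'I_N -> 'I_n := widen_ord leNn.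
have low_inj : injective low by move=> i j /(congr1 val) /= /val_inj.
pose L := low @: [set: 'I_N].
have cL : #|L| = N by rewrite card_imset // cardsT card_ord.
have cLC : #|~: L| + N = n by rewrite -cL addnC cardsC card_ord.
pose E1 := [set e : {set 'I_n} | (#|e| == 2) && ~~ (e \subset L)].
pose E2 := [set low @: (e : {set 'I_N}) | e in F].
have E2L e : e \in E2 -> e \subset L by case/imsetP=> e' _ ->; apply: imsetS; apply: subsetT.
have cE1 : #|E1| = 'C(n, 2) - 'C(N, 2).
  have := card_draws 'I_n 2; rewrite card_ord => <-.
  have := cards_draws L 2; rewrite cL => <-.
  set D := [set A : {set 'I_n} | #|A| == 2].
  rewrite (_ : E1 = D :\: [set A : {set 'I_n} | A \subset L & #|A| == 2]).
    rewrite cardsD (setIidPr _) //; apply/subsetP => e; by rewrite !inE => /andP[].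
  by apply/setP => e; rewrite !inE; case: (_ == 2); rewrite ?andbT ?andbF.
have cE : #|E1 :|: E2| = #|E1| + #|F|.
  rewrite -[in RHS](card_imset _ (imset_inj low_inj)); apply/eqP; rewrite leq_card_setU.
  rewrite disjoint_subset; apply/subsetP => e; rewrite !inE => /andP[_ eL].
  by apply: contra eL; apply: E2L.
rewrite -cE1 -cE; apply: ex_ge.
  apply/forall_inP => e; rewrite inE => /orP[|/imsetP[e' e'F ->]].
    by rewrite inE => /andP[].
  by rewrite card_imset // (edge_card sF).
apply/negP => /(containsP _ (simple_disj_copies simpleB _))[f [finj fe]].
(* The copies are disjoint and only [s1 * t.+1 - 1] vertices lie outside [L], so some copy places
   fewer than [s1] pattern vertices there. *)
pose c (i : 'I_t.+1) := [set x | f (i, x) \notin L].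
have [i ci] : exists i, #|c i| < s1.
  apply: NNPP => no; have : s1 * t.+1 <= #|~: L|; last first.
    by move: cLC nE; clear; lia.
  have -> : s1 * t.+1 = \sum_(i < t.+1) s1 by rewrite sum_nat_const card_ord mulnC.
  apply: leq_trans (_ : \sum_(i < t.+1) #|c i| <= _).
    by apply: leq_sum => i _; rewrite leqNgt; apply/negP => lt; apply: no; exists i.
  have -> : \sum_(i < t.+1) #|c i| = #|[set p | f p \notin L]|.
    rewrite -[RHS]sum1dep_card (eq_bigr (fun i => \sum_(x | f (i, x) \notin L) 1)).
      by rewrite pair_big_dep /=; apply: eq_bigl => -[i x].
    by move=> i _; rewrite sum1dep_card.
  rewrite -(card_imset _ finj); apply: subset_leq_card; apply/subsetP => _ /imsetP[p + ->].
  by rewrite !inE.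
have [|S SC cS] := @subset_card_eq _ (~: c i) s2.+1.
  by move: (cardsC (c i)) (cardsC W1) ci; rewrite -/s1 -/s2; clear; lia.
have fL x : x \in S -> f (i, x) \in L.
  by move/(subsetP SC); rewrite !inE negbK.
pose g x := odflt (Ordinal N_gt0) [pick j | low j == f (i, x)].
have gE x : x \in S -> low (g x) = f (i, x).
  move/fL/imsetP=> [j _ fj]; rewrite /g; case: pickP => [j' /eqP//|/(_ j)].
  by rewrite fj eqxx.
case/negP: nF; apply/existsP; exists S; rewrite cS eqxx; apply/(embeds_onP _ _ simpleB).
exists g; split=> [x y xS yS eqg | x y xS yS xy].
  have : f (i, x) = f (i, y) by rewrite -!gE // eqg.
  by move/finj => [].
have := fe _ _ (disj_copies_adj i xy); rewrite /adj -!gE // inE => /orP[|/imsetP[e eF]].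
  by rewrite inE subUset !sub1set !gE // !fL // andbF.
rewrite -imset_set1 -(imset_set1 low (g y)) -imsetU => /(imset_inj low_inj) eqe.
by rewrite eqe.
Qed.

End LowerBound.

Lemma bin2_double n : 2 * 'C(n, 2) + n = n * n.
Proof. by elim: n => // n IH; rewrite binS bin1; move: IH; clear; lia. Qed.

(** * Upper bound: stability and choice of parameters *)

Section UpperBound.
Variables (T : finType) (B : {set {set T}}) (W1 : {set T}).
Hypothesis simpleB : simple_graph B.
Hypothesis connB : connected_graph B.
Hypothesis bip : forall x y, adj B x y -> (x \in W1) != (y \in W1).
Let s1 := #|W1|.
Let s2 := #|~: W1|.
Let s := #|T|.
Hypothesis s1_gt1 : 1 < s1.
Hypothesis s12 : s1 <= s2.

Variables (n t : nat) (E : {set {set 'I_n}}).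
(** Errors are measured in units of [c], about n/(576 s1 s): [s * s * t] fits into one unit, and
    nearly full means missing at most 64 of them. [M] is the ratio used for popular vertices. *)
Let k := 576 * s1 * s.
Let c := n %/ k.
Let exB := ex n (contains B).
Let M := 16 * k * s.
Hypothesis simpleE : simple_graph E.
Hypothesis upper_t : k * (s * s * t) <= n.
Hypothesis lower_t : 16 * k * s1 <= t.
Hypothesis lower_t_ex : 16 * k * exB <= t * n.
Hypothesis n_large : 2 * s * (expn M s1 * s2) < c.
Hypothesis no_packing : ~ packing (hosts (adj B) (adj E)) t.+1 setT.

Let sE : s = s1 + s2.
Proof. exact: cardT_W1. Qed.

Let s1_gt0 : 0 < s1. Proof. exact: ltnW. Qed.
Let s_ge4 : 4 <= s. Proof. by rewrite sE; move: s1_gt1 s12; clear; lia. Qed.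
Let k_gt0 : 0 < k. Proof. by rewrite !muln_gt0 s1_gt0; move: s_ge4; clear; lia. Qed.
Let c_gt0 : 0 < c. Proof. by apply: leq_trans n_large. Qed.
Let kc : k * c <= n. Proof. by rewrite mulnC; apply: leq_trunc_div. Qed.
Let n_lt : n < 2 * k * c.
Proof.
have := ltn_ceil n k_gt0; rewrite -/c; move: (leq_mul (leqnn k) c_gt0).
by rewrite mulSn; clear; lia.
Qed.
Let sst : s * s * t <= c. Proof. by rewrite leq_divRL // mulnC. Qed.
Let t_gt0 : 0 < t.
Proof. by apply: leq_trans lower_t; rewrite muln_gt0 s1_gt0 andbT muln_gt0 k_gt0. Qed.

Lemma dense_complete_pair (U X R : {set 'I_n}) : #|U| <= s * t ->
  X \subset U -> R \subset ~: U -> t * c <= arcs (adj E) X R ->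
  exists P Q : {set 'I_n}, [/\ P \subset X, Q \subset R, #|P| = #|W1|, #|Q| = #|~: W1|
    & {in P & Q, forall p q, adj E p q}].
Proof.
move=> leU XU _ big.
have leX : #|X| <= s * t by apply: leq_trans leU; apply: subset_leq_card.
have leR : #|R| <= n by rewrite -[n in _ <= n]card_ord max_card.
(* Degrees below [e + s1] contribute at most half of [t * c], and yet [M * e] still exceeds [s * t],
   which bounds [#|X|]. *)
pose e := t %/ (8 * k).
have k8 : 0 < 8 * k by rewrite muln_gt0.
have te : t < e.+1 * (8 * k) by apply: ltn_ceil.
have et : e * (8 * k) <= t by apply: leq_trunc_div.
have e_gt0 : 0 < e.
  by rewrite divn_gt0 //; move: (leq_mul (leqnn k) s1_gt0) lower_t; clear; lia.
apply: (@complete_pair _ _ (adj_sym E) X R e M).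
  apply: leq_ltn_trans leX _.
  have tlt : t < 16 * k * e.
    by move: te (leq_mul (leqnn (8 * k)) e_gt0); rewrite mulSn; clear; lia.
  rewrite /M (mulnAC _ s) mulnC ltn_pmul2r //; exact: leq_trans s_ge4.
apply: leq_trans big.
have h1 : 2 * (#|R| * (e + s1)) <= t * c.
  apply: leq_trans (_ : 2 * (2 * k * c * (e + s1)) <= _).
    by rewrite leq_mul2l leq_mul2r (ltnW (leq_ltn_trans leR n_lt)) orbT.
  have h : 4 * k * (e + s1) <= t by move: et lower_t; clear; lia.
  by move: (leq_mul h (leqnn c)); clear; lia.
have h2 : 2 * (#|X| * (expn M s1 * s2)) < t * c.
  apply: leq_ltn_trans (_ : t * (2 * s * (expn M s1 * s2)) < _).
    by move: (leq_mul leX (leqnn (expn M s1 * s2))); clear; lia.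
  by rewrite ltn_pmul2l.
by rewrite -/s1 -/s2; move: h1 h2; clear; lia.
Qed.

Let N := n - s1 * t.+1 + 1.
Hypothesis many_edges :
  'C(n, 2) - 'C(N, 2) + ex N (contains_induced_k B s2.+1) < #|E|.

Let st_le : s1 * t.+1 <= c.
Proof.
apply: leq_trans sst; apply: leq_trans (_ : s * (s * t) <= _); last by rewrite mulnA.
apply: leq_mul; first by rewrite sE leq_addr.
apply: leq_trans (_ : 2 * t <= _); first by move: t_gt0; clear; lia.
by rewrite leq_mul2r (leq_trans _ s_ge4) ?orbT.
Qed.

Let nN : n + 1 = N + s1 * t.+1.
Proof.
have le : s1 * t.+1 <= n.
  apply: leq_trans st_le (leq_trans _ kc); exact: leq_pmull.
by rewrite /N; move: le; clear; lia.
Qed.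

Let arcs_total : n * n + 2 * ex N (contains_induced_k B s2.+1) + 2 + N
  <= arcs (adj E) setT setT + N * N + n.
Proof.
rewrite arcs_edges // edges_inT -(bin2_double n) -(bin2_double N).
by move: many_edges; clear; lia.
Qed.

(** For the union [U] of a maximal packing, nearly s1 t n arcs leave [U]. If its low-degree part [L]
    carried many of them, the two-phase packing would reach [t.+1] copies; hence almost all of them
    come from nearly full vertices, each carrying at most [n]. *)
Lemma stability :
  7 * (s1 * t) <= 7 * #|[set v | codeg (adj E) v setT <= 64 * c]| + t.
Proof.
set A0 := [set v | _].
have hosts_size Y : hosts (adj B) (adj E) Y -> 0 < #|Y| <= s.
  by case=> f fc <-; rewrite (card_copy fc) leqnn andbT; apply: leq_trans s_ge4.
have [||//|[U [_ _ leU noB]]] := @maximal_packing _ (hosts (adj B) (adj E)) s t setT hosts_size.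
- rewrite cardsT card_ord; apply: leq_trans kc; apply: leq_trans (leq_pmull c k_gt0).
  apply: leq_trans sst; rewrite -mulnA; apply: leq_pmull; exact: leq_trans s_ge4.
- exact: leq_trans s_ge4.
pose R := ~: U; pose w := s2 * #|U|.
have cU : w <= c.
  apply: leq_trans sst; rewrite -mulnA; apply: leq_mul => //.
  by rewrite sE leq_addl.
have RR : arcs (adj E) R R <= 4 * exB.
  have n_gt0 : 0 < n by apply: leq_trans kc; rewrite muln_gt0 k_gt0 c_gt0.
  rewrite -(leq_pmul2l n_gt0); apply: leq_trans (arcs_copy_free simpleB connB _ simpleE (W := R) _) _.
  - exact: leq_trans s_ge4.
  - by move=> f fc fR; apply: (noB (f @: setT)); [rewrite setTD | exists f].
  by rewrite -/exB mulnAC mulnC leq_mul2r -[n in _ <= n]card_ord max_card orbT.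
have ex8 : 8 * exB <= t * c.
  have k2 : 0 < 2 * k by rewrite muln_gt0 k_gt0.
  rewrite -(leq_pmul2l k2).
  apply: leq_trans (_ : t * n <= _); first by move: lower_t_ex; clear; lia.
  by move: (leq_mul (leqnn t) (ltnW n_lt)); clear; lia.
have UR : s1 * t * n <= arcs (adj E) U R + t * c.
  have := arcs_split (adj_sym E) (subsetT U); rewrite setTD -/R => tot.
  move: arcs_total; rewrite tot.
  have UU : arcs (adj E) U U <= c * t.
    apply: leq_trans (arcs_le_card _ _ _) (leq_trans (leq_mul leU leU) _).
    by move: (leq_mul sst (leqnn t)); clear; lia.
  have s1t : 2 * (s1 * t * (s1 * t.+1)) <= c * t.
    apply: leq_trans (leq_mul sst (leqnn t)).
    apply: leq_trans (_ : 2 * (s1 * t * (s1 * (2 * t))) <= _).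
      have t2 : t.+1 <= 2 * t by move: t_gt0; clear; lia.
      by rewrite !leq_mul2l t2 !orbT.
    apply: leq_trans (_ : (2 * s1) * (2 * s1) * t * t <= _); first by clear; lia.
    have le : 2 * s1 <= s by rewrite sE; move: s12; clear; lia.
    by rewrite !leq_mul.
  have mE : s1 * t <= n - N by move: nN s1_gt0; rewrite mulnS; clear; lia.
  have leNn : N <= n by move: nN s1_gt0; rewrite mulnS; move: (_ * t) => ?; clear; lia.
  (* (n - N)(n + N - 1) is twice the difference of the two binomials. *)
  have low : s1 * t * (2 * n) <= (n - N) * (n + N - 1) + s1 * t * (s1 * t.+1).
    have e1 : n + N - 1 + s1 * t.+1 = 2 * n by move: nN leNn (s1_gt0); rewrite mulnS; move: (s1 * t); clear; lia.
    by rewrite -e1 mulnDr leq_add2r leq_mul2r mE orbT.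
  have N_gt0 : 0 < N by rewrite /N addn1.
  have low2 : (n - N) * (n + N - 1) + N * N + n = n * n + N.
    have nE : n = n - N + N by rewrite subnK.
    move: (n - N) N_gt0 nE => m; case: N => // N' _ ->.
    by rewrite addnS subn1 /=; clear; lia.
  by move: low low2 UU s1t RR ex8; clear; lia.
pose L := U :\: A0; pose k1 := t %/ (8 * s1); pose d := 64 * c.
have s8 : 0 < 8 * s1 by rewrite muln_gt0.
have k1_le : k1 * (8 * s1) <= t by apply: leq_trunc_div.
have k1_gt : t < k1.+1 * (8 * s1) by apply: ltn_ceil.
have k_ge : 576 * s1 <= k by rewrite leq_pmulr // (leq_trans _ s_ge4).
have LU : L \subset U by apply: subsetDl.
have Ldeg : {in L, forall x, deg (adj E) x R <= n - d}.
  move=> x; rewrite !inE -ltnNge => /andP[lt _].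
  apply: leq_trans (degS _ _ (subsetT R)) _.
  by have := deg_codeg (adj E) x setT; rewrite cardsT card_ord /d; move: lt; clear; lia.
have UL : arcs (adj E) U R <= #|A0| * n + arcs (adj E) L R.
  rewrite (arcsIDl _ U R A0) leq_add2r; apply: leq_trans (arcs_le_card _ _ _) _.
  apply: leq_mul; first by apply: subset_leq_card; apply: subsetIr.
  by rewrite -[n in _ <= n]card_ord max_card.
have dn : d <= n.
  by move: kc (leq_mul k_ge (leqnn c)) (leq_mul s1_gt0 (leqnn c)); rewrite /d; clear; lia.
have s1n : s1 * n <= t * c.
  move: (leq_mul lower_t (leqnn c)) (leq_mul (leqnn s1) (ltnW n_lt)); clear.
  by move: (k * s1 * c) => *; lia.
have k1t : k1 <= t by apply: leq_trans k1_le; exact: leq_pmulr.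
have [big|small] := leqP (k1 * (s1 * (n - d) + s2 * #|U|) + t * c) (arcs (adj E) L R).
  case: no_packing; rewrite (_ : t.+1 = k1 + (t.+1 - k1)); last first.
    by rewrite subnKC // ltnW // ltnS.
  apply: (packing_two_phases bip (adj_sym E) s1_gt0 (U := U) (tau := t * c) _ LU Ldeg).
  - by move=> X Q; apply: dense_complete_pair.
  - by rewrite !setIT.
  rewrite !setIT card_ord -/s1 -/s2 -/w.
  (* Low degrees save at least 5tc arcs. This pays for [s1 * n] from the extra copy (at most tc),
     [t.+1 * w] (at most 2tc), the reserve [tau] (tc) and the deficit in [UR] (tc). *)
  have t64 : 5 * t <= 64 * (k1 * s1).
    move: k1_gt lower_t (leq_mul k_gt0 (leqnn s1)) (leq_mul k_ge (leqnn s1)).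
    rewrite mulSn; move: (leq_mul s1_gt0 (leqnn s1)); clear; lia.
  have tw : t.+1 * w <= 2 * (t * c).
    rewrite mulnA; apply: leq_mul cU; move: t_gt0; clear; lia.
  have tE : t.+1 = k1 + (t.+1 - k1) by rewrite subnKC // ltnW // ltnS.
  have nE : n = n - d + d by rewrite subnK.
  have geX : 64 * (k1 * s1) * c <= s1 * t * n.
    by move: (leq_mul (leq_mul (leqnn s1) k1t) dn); rewrite /d; clear; lia.
  move: UR s1n (leq_mul t64 (leqnn c)) tw; rewrite -/R.
  have -> : k1 * (s1 * (n - d) + w) + (t.+1 - k1) * (s1 * n + w)
      = s1 * t * n + s1 * n + t.+1 * w - 64 * (k1 * s1) * c.
    apply/eqP; rewrite -(eqn_add2r (64 * (k1 * s1) * c)); apply/eqP.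
    rewrite subnK; last by apply: leq_trans geX _; clear; lia.
    have -> : s1 * t * n + s1 * n + t.+1 * w = t.+1 * (s1 * n + w) by clear; lia.
    have : k1 * (s1 * n) = k1 * (s1 * (n - d)) + k1 * (s1 * d) by rewrite -!mulnDr -nE.
    by rewrite [in t.+1 * _]tE /d; move: (t.+1 - k1) (n - _) => K P; clear; lia.
  by move: geX (arcs _ U R) => geX u; move: geX; clear; lia.
(* Now [L] carries at most tn/8 + 2tc arcs and [UR] loses another tc; with 168c at most n the total
   is (1/8 + 3/168) tn = tn/7. *)
have c168 : 168 * c <= n.
  by move: kc (leq_mul k_ge (leqnn c)) (leq_mul s1_gt0 (leqnn c)); clear; lia.
have n_gt0 : 0 < 8 * n by move: c168 c_gt0; clear; lia.
rewrite -(leq_pmul2l n_gt0).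
have le1 : k1 * (s1 * (n - d) + w) <= k1 * (s1 * n) + t * c.
  by rewrite mulnDr leq_add ?leq_mul // leq_subr.
have le2 : 8 * (k1 * (s1 * n)) <= t * n.
  by move: (leq_mul k1_le (leqnn n)); clear; lia.
move: small UR UL le1 le2 (leq_mul c168 (leqnn t)); rewrite -/R -/w.
by move: (arcs _ U R) (arcs _ L R) (k1 * (s1 * n)) (k1 * _) => x y z u; clear; lia.
Qed.

Hypothesis lower_t_sq : 32 * s1 * s * n <= t * t.

Lemma too_many_edges : False.
Proof.
have stab := stability; set A0 := [set v | _] in stab.
pose d := 64 * c; pose m := s1 * t.+1 - 1.
have mE : m + 1 = s1 * t.+1 by rewrite subnK // muln_gt0 s1_gt0.
(* Capping the size at [m] makes [m - a] a genuine difference; stability then gives q at most s1 +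
   t/7. *)
have [A AA0 cA] := subset_card_eq (geq_minl #|A0| m).
pose a := #|A|; pose q := m - a.
have am : a <= m by rewrite /a cA geq_minr.
have aq : a + q = m by rewrite subnKC.
have q7 : 7 * q <= 7 * s1 + t.
  move: aq mE stab; rewrite /a cA mulnS; move: (s1 * t) (#|A0|) => x y; clear; lia.
have Adeg : {in A, forall v, codeg (adj E) v setT <= d}.
  by move=> v /(subsetP AA0); rewrite inE.
(* Products are atoms for [lia], so [y576] and [y1] to [y4] compare [c], [s1 * c], [s * c],
   [s1 * s * c] and [n] once and for all. *)
have y576 : 576 * (s1 * s * c) <= n by move: kc; rewrite /k -!mulnA.
have y1 : 2 * (s * c) <= s1 * s * c by rewrite -mulnA leq_mul2r s1_gt1 orbT.
have y2 : 4 * (s1 * c) <= s1 * s * c.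
  by rewrite mulnCA -mulnA leq_mul2l (mulnC s) (mulnC 4) leq_mul2l s_ge4 !orbT.
have y3 : 4 * c <= s * c by rewrite leq_mul2r s_ge4 orbT.
have y4 : 2 * c <= s1 * c by rewrite leq_mul2r s1_gt1 orbT.
have ss1 : s1 <= s by rewrite sE leq_addr.
have t16 : 16 * s <= k by rewrite /k; move: (leq_mul s1_gt0 (leqnn s)); clear; lia.
have tk : 16 * k <= t by move: lower_t (leq_mul (leqnn k) s1_gt0); clear; lia.
have ts1 : 256 * s * s1 <= t.
  by move: lower_t (leq_mul t16 (leqnn s1)); clear; lia.
have ts : 256 * s <= t by move: tk t16; clear; lia.
have s4t : 4 * (s * t) <= c.
  by apply: leq_trans sst; rewrite -(mulnA s) leq_mul2r s_ge4 orbT.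
have st1 : s * t.+1 <= c by rewrite mulnS; move: s4t (leq_mul (leqnn s) t_gt0); clear; lia.
have sc : s <= c by move: st1; rewrite mulnS; apply: leq_trans; apply: leq_addr.
have ac : a <= c by move: am mE st_le; clear; lia.
have s1c : s1 <= c by apply: leq_trans sc.
have tc : t <= c by apply: leq_trans st1; rewrite mulnS (leq_trans _ (leq_addl _ _)) // leq_pmull // (leq_trans _ s_ge4).
have s2s : s2 < s by rewrite sE; move: s1_gt0; clear; lia.
have at2 : s1 * t <= 2 * a.
  by move: aq mE q7 ts s_ge4 (leq_mul s1_gt1 (leqnn t)); rewrite mulnS; clear; lia.
have ta : t <= a by move: at2 (leq_mul s1_gt1 (leqnn t)); clear; lia.
have qt : q <= t by move: q7 ts1 ss1 ts; clear; lia.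
have tss : 8 * (s * s) <= t.
  rewrite -(leq_pmul2r t_gt0); apply: leq_trans lower_t_sq.
  have := leq_mul (leq_mul s1_gt0 (leq_trans (isT : 0 < 4) s_ge4)) (leq_trans (leq_pmull _ k_gt0) upper_t).
  by clear; lia.
have n_gt0 : 0 < n by apply: leq_trans kc; rewrite muln_gt0 k_gt0 c_gt0.
have cAC : a + #|~: A| = n by rewrite /a cardsC card_ord.
have NE : N + q = #|~: A|.
  by move: nN mE aq cAC; clear; lia.
(* The threshold [n %/ (2 * s)] exceeds the 64 s1 c + 3c vertices a star must avoid or use, while
   [s] times it is at most n/2 and so at most [N]. *)
apply: (@counting_contradiction T 'I_n (adj B) W1 (adj E) bip (adj_sym E) (adj_irr simpleE)
  s1_gt0 A q t d (n %/ (2 * s)) N (ex N (contains_induced_k B s2.+1)) exB) => //.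
- by rewrite -/a -/s1; move: aq mE; clear; lia.
(* Here the 1/7 matters: 4(s1-1)q is about 4/7 of s1 t at most, well below [a]. *)
- rewrite -/a -/s1; have := leq_mul (leqnn (4 * s1.-1)) q7.
  have [p pE] : exists p, s1 = p.+1 by exists s1.-1; rewrite prednK.
  have := ts1; have := leq_mul ss1 (leqnn s1); move: mE aq q7 ts ss1 s_ge4.
  by rewrite !pE /= mulnS; clear; lia.
- rewrite card_ord -/s1 -/s2 -/s -/a /d.
  by move: y576 y1 y2 y3 y4 st1 ac sc s2s; clear; lia.
- rewrite -/s1 -/s2 -/s leq_divRL ?muln_gt0 ?(leq_trans _ s_ge4) //.
  have z : s1 * d + s * t.+1 + q.+1 + s2 <= 64 * (s1 * c) + 3 * c.
    have := qt; move: st1 s2s sc s_ge4 ts; rewrite /d; clear; nia.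
  by move: (leq_mul z (leqnn (2 * s))) y576 y1 y2 y3 y4; clear; lia.
- rewrite -/s; move: (leq_trunc_div n (2 * s)) y576 y1 y2 y3 y4 nN st_le.
  by move: (n %/ (2 * s)) => z; clear; lia.
(* The square-root bound on [t] enters here: [a] is at least s1 t/2, hence at least t, so a^2 is at
   least 32 s1 s n. *)
- rewrite card_ord -/s1 -/s2 -/a.
  have an : a <= n by rewrite -cAC leq_addr.
  have e1 : s1 * n * (s2 + 1) <= s1 * n * s by rewrite leq_mul2l addn1 s2s orbT.
  have e2 : s1 * a <= s1 * n by rewrite leq_mul2l an orbT.
  have e3 : 4 * (t * t) <= s1 * t * (s1 * t).
    by rewrite mulnACA leq_mul2r (leq_mul s1_gt1 s1_gt1) orbT.
  by move: (leq_mul at2 at2) e1 e2 e3 lower_t_sq; clear; lia.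
- rewrite card_ord -/s -/s2 -/a -/exB.
  have sk : s <= k by move: t16; clear; lia.
  have e1 : 16 * (s * exB) <= t * n.
    by move: (leq_mul sk (leqnn exB)) lower_t_ex; clear; lia.
  have e2 : 8 * (s * s2 * n) <= t * n.
    apply: leq_trans (_ : (8 * (s * s)) * n <= _).
      by rewrite -!mulnA leq_mul2l !mulnA leq_mul2r leq_mul2l (ltnW s2s) !orbT.
    by rewrite leq_mul2r tss orbT.
  by move: (leq_mul ta (leqnn n)) e1 e2; clear; lia.
- rewrite card_ord -/s -/s2 -/a /d.
  have sq : s * q <= s * t by rewrite leq_mul2l qt orbT.
  by move: y576 y1 y2 y3 y4 st1 ac sc s2s s4t sq qt tc (c_gt0); rewrite mulnS; clear; lia.
- move=> X leX noS; exact: (arcs_ex_induced simpleB (Ordinal n_gt0) simpleE leX noS).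
- move=> X noX; rewrite card_ord; apply: arcs_copy_free => //.
  exact: leq_trans s_ge4.
have := arcs_split (adj_sym E) (subsetT A); rewrite setTD => tot.
move: arcs_total; rewrite tot -[in n * n]cAC -[X in _ + _ + X <= _]/N.
move: (arcs_codeg (adj E) A A) (arcs_codeg (adj E) (~: A) A) cAC.
rewrite (arcsC (adj_sym E) (~: A) A) -/a.
move: (\sum_(x in A) _) (\sum_(x in ~: A) _) (arcs _ A A) (arcs _ A (~: A)) (arcs _ (~: A) (~: A)) => x y z u v.
by move: (#|~: A|) => b; clear; lia.
Qed.

End UpperBound.

(** * From the real bounds on t to integer inequalities *)

Section RealBounds.
Local Open Scope R_scope.
(** [a], [b], [v], [y], [u], [e] stand for s1, s, n, ex(n, B), t and Euler's number. The estimates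
    [2 <= e] and ab at most b^5/a suffice, as 16 * 576 is below 2 * 12800 and 576 below 2 * 1024. *)
Lemma real_bounds (a b v y u e : R) :
  1 <= a -> a <= b -> 2 <= v -> 0 <= y -> 0 <= u -> 2 <= e ->
  12800 * e * b ^ 5 / a * (y / (v - 1) + 576 * e * a * b ^ 2) <= u ->
  u <= v / (1024 * e * a * b ^ 3) ->
  16 * (576 * a * b) * a <= u /\ 16 * (576 * a * b) * y <= u * v /\
  576 * a * b * (b * b * u) <= v.
Proof.
intros a1 ab v2 y0 u0 e2 lo up.
set (q := b ^ 5 / a) in *. set (z := y / (v - 1)) in *.
assert (b1 : 1 <= b) by lra.
assert (aq : a * b <= q).
{ unfold q. apply Rmult_le_reg_r with a; [lra|].
  replace (b ^ 5 / a * a) with (b ^ 5) by (field; lra).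
  assert (h1 : a * a <= b * b) by (apply Rmult_le_compat; lra).
  assert (h2 : 1 <= b * b) by (apply Rle_trans with (1 * 1); [lra | apply Rmult_le_compat; lra]).
  assert (h3 : a * a * 1 <= b * b * (b * b)) by (apply Rmult_le_compat; nra).
  replace (a * b * a) with (a * a * 1 * b) by ring.
  replace (b ^ 5) with (b * b * (b * b) * b) by ring.
  apply Rmult_le_compat_r; lra. }
assert (ab0 : 1 <= a * b) by (apply Rle_trans with (1 * 1); [lra | apply Rmult_le_compat; lra]).
assert (z0 : 0 <= z) by (unfold z; apply Rmult_le_pos; [lra | left; apply Rinv_0_lt_compat; lra]).
assert (yz : y = z * (v - 1)) by (unfold z; field; lra).
assert (lo' : 12800 * (e * q) * (z + 576 * e * a * b ^ 2) <= u).
{ eapply Rle_trans; [|exact lo]. right. unfold q, Rdiv. ring. }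
clear lo.
assert (eq2 : 2 * q <= e * q) by (apply Rmult_le_compat_r; lra).
assert (w0 : a <= e * a * b ^ 2).
{ assert (1 <= b ^ 2) by (apply pow_R1_Rle; lra).
  assert (1 * a <= e * a) by (apply Rmult_le_compat_r; lra).
  replace a with (1 * a * 1) at 1 by ring. apply Rmult_le_compat; lra. }
set (w := e * a * b ^ 2) in *.
assert (lo2 : 12800 * (2 * q) * (z + 576 * w) <= u).
{ eapply Rle_trans; [|exact lo'].
  replace (576 * e * a * b ^ 2) with (576 * w) by (unfold w; ring).
  apply Rmult_le_compat_r; lra. }
assert (qz : 0 <= q * z) by (apply Rmult_le_pos; lra).
assert (qw : a * b * a <= q * w) by (apply Rmult_le_compat; lra).
assert (abz : a * b * z <= q * z) by (apply Rmult_le_compat_r; lra).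
assert (aba : 0 <= a * b * a) by (apply Rmult_le_pos; lra).
split; [lra|split].
- rewrite yz.
  assert (h : 9216 * (a * b * z) <= u) by lra.
  replace (16 * (576 * a * b) * (z * (v - 1))) with (9216 * (a * b * z) * (v - 1)) by ring.
  apply Rmult_le_compat; try lra.
  apply Rmult_le_pos; [lra|]. apply Rmult_le_pos; lra.
- assert (b3 : 1 <= b ^ 3) by (apply pow_R1_Rle; lra).
  assert (p0 : 0 < a * b ^ 3) by (apply Rmult_lt_0_compat; lra).
  assert (d0 : 2 * (a * b ^ 3) <= e * (a * b ^ 3)) by (apply Rmult_le_compat_r; lra).
  set (D := 1024 * e * a * b ^ 3) in *.
  assert (DE : D = 1024 * (e * (a * b ^ 3))) by (unfold D; ring).
  assert (uD : u * D <= v).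
  { apply Rle_trans with (v / D * D); [apply Rmult_le_compat_r; lra|].
    right. field. lra. }
  eapply Rle_trans; [|exact uD].
  replace (576 * a * b * (b * b * u)) with (u * (576 * (a * b ^ 3))) by ring.
  apply Rmult_le_compat_l; lra.
Qed.
End RealBounds.

Lemma nat_bounds (s1 s n t x : nat) : 0 < s1 -> s1 <= s -> 1 < n ->
  Rle (Rmax (sqrt (INR (32 * s1 * s * n)))
        (12800 * exp 1 * INR (s ^ 5) / INR s1 *
          (INR x / (INR n - 1) + 576 * exp 1 * INR s1 * INR (s ^ 2)))%R) (INR t) ->
  Rle (INR t) (INR n / (1024 * exp 1 * INR s1 * INR (s ^ 3)))%R ->
  [/\ 32 * s1 * s * n <= t * t, 16 * (576 * s1 * s) * s1 <= t,
      16 * (576 * s1 * s) * x <= t * n & 576 * s1 * s * (s * s * t) <= n].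
Proof.
move=> s1_gt0 ss1 n_gt1 lo up.
have toR m p : (INR m <= INR p)%R -> m <= p by move=> /INR_le/leP.
have ofR m p : m <= p -> (INR m <= INR p)%R by move/leP/le_INR.
have a1 : (1 <= INR s1)%R by apply: (ofR 1).
have ab : (INR s1 <= INR s)%R by apply: ofR.
have n1 : (2 <= INR n)%R by apply: (ofR 2).
have x0 : (0 <= INR x)%R by apply: pos_INR.
have t0 : (0 <= INR t)%R by apply: pos_INR.
have e2 : (2 <= exp 1)%R by have := exp_ineq1_le 1; lra.
have lo1 := Rle_trans _ _ _ (Rmax_l _ _) lo.
have lo2 := Rle_trans _ _ _ (Rmax_r _ _) lo.
have sq : 32 * s1 * s * n <= t * t.
  apply: toR; rewrite -[in X in (_ <= X)%R]multE mult_INR.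
  rewrite -(sqrt_sqrt _ (pos_INR _)); apply: Rmult_le_compat => //; exact: sqrt_pos.
move: lo2 up; rewrite !pow_INR.
move=> /(real_bounds a1 ab n1 x0 t0 e2) h /h [h1 [h2 h3]].
by split=> //; apply: toR; rewrite -!multE !mult_INR (INR_IZR_INZ 576) ?(INR_IZR_INZ 16).
Qed.

Theorem theorem1p12 (s1 s2 : nat) (T : finType) (B : {set {set T}}) (W1 : {set T}) :
  2 <= s1 -> s1 <= s2 ->
  bipartite_parts B W1 s1 s2 ->
  connected_graph B ->
  cover_number B = s1 ->
  let s := s1 + s2 in
  exists n0 : nat, forall n : nat, n0 <= n ->
    forall t : nat,
      Rle (Rmax (sqrt (INR (32 * s1 * s * n)))
            (12800 * exp 1 * INR (s ^ 5) / INR s1 *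
              (INR (ex n (contains B)) / (INR n - 1)
               + 576 * exp 1 * INR s1 * INR (s ^ 2)))%R) (INR t) ->
      Rle (INR t) (INR n / (1024 * exp 1 * INR s1 * INR (s ^ 3)))%R ->
      ex n (contains (disj_copies t.+1 B)) =
        'C(n, 2) - 'C(n - s1 * t.+1 + 1, 2)
        + ex (n - s1 * t.+1 + 1) (contains_induced_k B s2.+1).
Proof.
move=> s1_gt1 s12 [simpleB cW1 cW2 partB] connB coverB s.
have bip x y : adj B x y -> (x \in W1) != (y \in W1).
  move=> xy; have := partB _ xy; have := edge_card simpleB xy; rewrite cards2.
  case: (eqVneq x y) => // neq _.
  rewrite setIUl => c1; apply/negP => /eqP eqW; move: c1.
  case: (boolP (x \in W1)) eqW => xW /esym yW.
    rewrite (setIidPl _) ?sub1set // (setIidPl _) ?sub1set ?yW // cards2 neq //.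
  rewrite -[[set x] :&: W1]setIC -[[set y] :&: W1]setIC.
  by rewrite !(disjoint_setI0 _) ?setU0 ?cards0 // disjoint_sym disjoints1 ?yW.
have sE : s = #|T| by rewrite /s -cW1 -cW2 cardsC.
(* [K] is one more than the bound that [n %/ k] must exceed for dense pairs to contain complete
   ones; the extra 2 in the witness ensures [1 < n]. *)
pose k := 576 * s1 * s; pose K := 2 * s * (expn (16 * k * s) s1 * s2) + 1.
exists (k * K + 2) => n n_ge t lo up.
have s1_gt0 : 0 < s1 by apply: ltnW.
have ss1 : s1 <= s by apply: leq_addr.
have n_gt1 : 1 < n by apply: leq_trans n_ge; apply: leq_addl.
have [lower_sq lower_t lower_ex upper] := nat_bounds s1_gt0 ss1 n_gt1 lo up.
have s_gt0 : 0 < s by apply: leq_trans ss1.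
have k_gt0 : 0 < k by rewrite !muln_gt0 s1_gt0 s_gt0.
have c_large : 2 * s * (expn (16 * k * s) s1 * s2) < n %/ k.
  rewrite leq_divRL // mulnC -addn1; apply: leq_trans n_ge; exact: leq_addr.
have t_gt0 : 0 < t by apply: leq_trans lower_t; rewrite !muln_gt0 s1_gt0 s_gt0.
(* This makes the subtraction in [n - s1 * t.+1 + 1] genuine. *)
have le_n : s1 * t.+1 <= n.
  have st : t <= s * (s * s * t) by rewrite !mulnA leq_pmull // !muln_gt0 s_gt0.
  apply: leq_trans upper; apply: leq_trans (_ : s1 * (2 * t) <= _).
    by rewrite leq_mul2l; move: t_gt0; clear; lia.
  by move: (leq_mul (leqnn s1) st); clear; lia.
apply/eqP; rewrite eqn_leq; apply/andP; split; last first.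
  rewrite -cW1 -cW2; apply: ex_disj_copies_ge => //; rewrite ?cW1 ?addn1 //.
  by rewrite addSn subnK.
apply: ex_le => E simpleE noE; rewrite leqNgt; apply/negP => many.
have v0 : 'I_n := Ordinal (ltnW n_gt1).
subst s1 s2; rewrite /k sE in c_large lower_t lower_ex upper lower_sq.
apply: (too_many_edges simpleB connB bip s1_gt1 s12 simpleE upper lower_t lower_ex c_large _ many lower_sq).
by move=> pk; case/negP: noE; apply: packing_contains v0 pk.
Qed.
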